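(* Let $K$ be an algebraically closed field of characteristic $p\ge 0$. Let $X\subset\mathbb{P}^{n+1}$ be a hypersurface of dimension $n\ge 1$ and degree $d\ge 4$ with $s(X)\le n-2$. Let $P\in X$ (resp. $P\in\mathbb{P}^{n+1}\setminus X$) be a Galois point for $X$, and let $d-1=p^el$ (resp. $d=p^el$), where $l$ is not divisible by $p$ if $p>0$. Then $l$ divides $p^e-1$, and the Galois group $G_P(X)$ is isomorphic to a semidirect product of $(\mathbb{Z}/p\mathbb{Z})^{\oplus e}$ (as a normal subgroup) and $\mathbb{Z}/l\mathbb{Z}$ (as a quotient).
   Context: A hypersurface is irreducible and reduced. $s(X):=\dim\mathrm{Sing}(X)$, with $\dim\emptyset=-1$. A point $P\in X_{\rm sm}\cup(\mathbb{P}^{n+1}\setminus X)$ ($X_{\rm sm}$ the smooth locus) is a Galois point for $X$ if the function field extension $K(X)/K(\mathbb{P}^n)$ induced by the projection $\pi_P:X\dashrightarrow\mathbb{P}^n$ from $P$ is Galois; $G_P(X)$ denotes its Galois group. Convention when $p=0$: $e=0$ and $p^e=1$, so that $l=d-1$ (resp. $l=d$) and the group is $\mathbb{Z}/l\mathbb{Z}$. *)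

(* Defs.v *)
From HB Require Import structures.
From mathcomp Require Import all_boot all_order all_algebra all_fingroup all_field.
From mathcomp Require Import ring_quotient fraction.
From mathcomp Require Import boolp classical_sets.
From mathcomp Require Import mpoly.

Set Implicit Arguments.
Unset Strict Implicit.
Unset Printing Implicit Defensive.

Import GRing.Theory.

Local Open Scope ring_scope.
Local Open Scope classical_set_scope.

Definition has_char (K : nzRingType) (p : nat) : Prop :=
  if p == 0%N then [pchar K] =i pred0 else p \in [pchar K].

Definition principal (R : comNzRingType) (F : R) : {pred R} :=
  fun G => `[< exists H, G = H * F >].

(* A hypersurface of degree d in P^(n+1) is given by its equation; it is
   irreducible and reduced, i.e. integral, when its homogeneous coordinate ring
   is an integral domain, i.e. (F) is a (proper) prime ideal. *)
Record hypersurface (K : closedFieldType) (n d : nat) := Hypersurface {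
  equation : {mpoly K[n.+2]};
  equation_homog : equation \is d.-homog;
  equation_neq0 : equation != 0;
  equation_proper : 1 \notin principal equation;
  equation_prime : prime_idealr_closed (principal equation)
}.

Section CoordinateRing.
Variables (K : closedFieldType) (n d : nat) (X : hypersurface K n d).

Definition hs_ideal : {pred {mpoly K[n.+2]}} := principal (equation X).

Lemma hs_ideal_closed : idealr_closed hs_ideal.
Proof.
split; [|exact: equation_proper|].
  by apply/asboolP; exists 0; rewrite mul0r.
move=> a u v /asboolP[u' ->] /asboolP[v' ->]; apply/asboolP.
by exists (a * u' + v'); rewrite mulrDl mulrA.
Qed.

HB.instance Definition _ := isIdealr.Build _ hs_ideal hs_ideal_closed.
HB.instance Definition _ :=
  isPrimeIdealrClosed.Build _ hs_ideal (@equation_prime _ _ _ X).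

Definition coord_ring := {ideal_quot hs_ideal}.

HB.instance Definition _ := GRing.ComNzRing.on coord_ring.

(* Classical units and inverses: forming {fraction _} requires an idomainType. *)
Definition coord_unit (x : coord_ring) : bool := `[< exists y, y * x = 1 >].

Definition coord_inv (x : coord_ring) : coord_ring :=
  if pselect (exists y, y * x = 1) is left e then projT1 (cid e) else x.

Lemma coord_mulVx : {in coord_unit, left_inverse 1 coord_inv *%R}.
Proof.
move=> x /asboolP xu; rewrite /coord_inv; case: pselect => // e.
by case: (cid e).
Qed.

Lemma coord_unitPl (x y : coord_ring) : y * x = 1 -> coord_unit x.
Proof. by move=> yx; apply/asboolP; exists y. Qed.

Lemma coord_invr_out : {in [predC coord_unit], coord_inv =1 id}.
Proof.
move=> x /negP xu; rewrite /coord_inv; case: pselect => // e.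
by case: xu; apply/asboolP.
Qed.

HB.instance Definition _ := GRing.ComNzRing_hasMulInverse.Build coord_ring
  coord_mulVx coord_unitPl coord_invr_out.

Lemma coord_idomain : GRing.integral_domain_axiom coord_ring.
Proof. exact: (@Quotient.rquot_IdomainAxiom _ hs_ideal). Qed.

HB.instance Definition _ :=
  GRing.ComUnitRing_isIntegral.Build coord_ring coord_idomain.

Definition coord_class (G : {mpoly K[n.+2]}) : coord_ring :=
  (\pi_({ideal_quot hs_ideal}) G)%qT.

Definition coord_frac (G H : {mpoly K[n.+2]}) : {fraction coord_ring} :=
  tofrac (coord_class G) / tofrac (coord_class H).

(* K(X) is the subfield of homogeneous fractions of degree 0 in Frac S(X). *)
Definition function_field : set {fraction coord_ring} :=
  [set f | exists m (G H : {mpoly K[n.+2]}),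
     [/\ G \is m.-homog, H \is m.-homog, H \notin hs_ideal
       & f = coord_frac G H]].

End CoordinateRing.

Arguments function_field {K n d} X.

Section ProjectiveSets.
Variables (K : fieldType) (N : nat).

(* Points of P^(N-1) are represented by nonzero vectors of K^N, and subsets of
   P^(N-1) by the corresponding cones with the origin removed. *)
Definition peval (G : {mpoly K[N]}) (v : 'rV[K]_N) : K := G.@[fun i => v 0 i].

Definition proj_closed (Z : set 'rV[K]_N) : Prop :=
  exists S : set {mpoly K[N]},
    (forall G, S G -> exists m, G \is m.-homog) /\
    Z = [set v | v != 0 /\ forall G, S G -> peval G v = 0].

Definition proj_irreducible (Z : set 'rV[K]_N) : Prop :=
  [/\ proj_closed Z, Z !=set0 &
      forall A B, proj_closed A -> proj_closed B ->
        Z `<=` A `|` B -> Z `<=` A \/ Z `<=` B].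

Definition irreducible_chain (Z : set 'rV[K]_N) (m : nat) : Prop :=
  exists C : nat -> set 'rV[K]_N,
    [/\ forall i, (i <= m)%N -> proj_irreducible (C i),
        forall i, (i < m)%N -> C i `<` C i.+1
      & C m `<=` Z].

(* s is the Krull dimension of the closed set Z, with dim set0 = -1. *)
Definition is_dim (Z : set 'rV[K]_N) (s : int) : Prop :=
  (forall m, irreducible_chain Z m -> m%:Z <= s) /\
  (s = -1 \/ exists2 m, irreducible_chain Z m & s = m%:Z).

End ProjectiveSets.

Section GaloisPoints.
Variables (K : closedFieldType) (n d : nat) (X : hypersurface K n d).

Definition on_hs (v : 'rV[K]_n.+2) : bool := peval (equation X) v == 0.

(* Jacobian criterion (K is algebraically closed). *)
Definition sing_locus : set 'rV[K]_n.+2 :=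
  [set v | [/\ v != 0, on_hs v & forall i, peval (equation X)^`M(i) v = 0]].

Definition smooth_locus : set 'rV[K]_n.+2 :=
  [set v | [/\ v != 0, on_hs v & exists i, peval (equation X)^`M(i) v != 0]].

(* The columns of M are the coordinates x |-> x *m M of the projection
   P^(n+1) --> P^n; its center is P when they form a basis of the linear
   forms vanishing at P. *)
Definition projection_from (P : 'rV[K]_n.+2) (M : 'M[K]_(n.+2, n.+1)) : Prop :=
  \rank M = n.+1 /\ P *m M = 0.

Definition projection_forms (M : 'M[K]_(n.+2, n.+1)) :
    n.+1.-tuple {mpoly K[n.+2]} :=
  [tuple \sum_i M i j *: 'X_i | j < n.+1].

(* The image of K(P^n) in K(X) under pull-back along the projection. *)
Definition pullback_field (M : 'M[K]_(n.+2, n.+1)) :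
    set {fraction coord_ring X} :=
  [set f | exists m (g h : {mpoly K[n.+1]}),
     let G := g \mPo projection_forms M in
     let H := h \mPo projection_forms M in
     [/\ g \is m.-homog, h \is m.-homog, H \notin hs_ideal X
       & f = coord_frac X G H]].

(* That P is a Galois point: the extension K(X) / K(P^n) is isomorphic, via
   [gp_emb], to a Galois extension [gp_top / gp_base] in the sense of the
   library (where a finite normal extension is a [splittingFieldType]). *)
Record galois_point (P : 'rV[K]_n.+2) := GaloisPoint {
  gp_neq0 : P != 0;
  gp_smooth : smooth_locus P \/ ~~ on_hs P;
  gp_proj : 'M[K]_(n.+2, n.+1);
  gp_projP : projection_from P gp_proj;
  gp_base : fieldType;
  gp_top : splittingFieldType gp_base;
  gp_emb : {rmorphism gp_top -> {fraction coord_ring X}};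
  gp_top_image : range gp_emb = function_field X;
  gp_base_image :
    range (fun c : gp_base => gp_emb c%:A) = pullback_field gp_proj;
  gp_galois : galois 1 {:gp_top}
}.

Definition galois_group (P : 'rV[K]_n.+2) (gP : galois_point P) :
    {group gal_of {:gp_top gP}} :=
  'Gal({:gp_top gP} / 1)%G.

End GaloisPoints.

(* G is isomorphic to a semidirect product of a normal subgroup isomorphic to
   (Z/p)^e by Z/l.  For e = 0 the first factor is trivial, whatever p is. *)
Definition is_semidirect_elab_cyclic (gT : finGroupType) (G : {group gT})
    (p e l : nat) : Prop :=
  exists N H : {group gT},
    [/\ (N ><| H = G)%g,
        N \isog [set: 'rV['Z_p]_e]%SET
      & H \isog Zp l].

(* Main.v *)
(** Choose coordinates in which [P] is the last coordinate point; write [x] for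
    the last variable, [A] for the ring of polynomials in the others,
    [F = a x^m + ...] for the equation of [X] as a polynomial in [x] over [A].
    Thus [m = d] and [a] is a constant if [P] is off [X], while [m = d - 1] and
    [a] is the tangent linear form at [P] if [P] is a smooth point of [X].

    Normality: if [t] is a fraction integral over [S = K[x_0..]/(F)], then
    [D_u F * t] lies in [S] for every direction [u] with [F(u) != 0] (the different
    of [S] over the polynomial ring obtained by projecting from [u] annihilates the
    integral closure modulo [S]), hence all partial derivatives of [F] lie in the
    conductor of [t].  As the singular locus has codimension at least 2 in [X], the
    conductor contains a regular pair, and therefore [t] is in [S].

    The element [a x] is integral over [A] and homogeneous, so its conjugates under
    the Galois group are integral too, i.e. they are (classes of) forms of degree 1
    or 2.  Comparing leading coefficients, and then reducing the equation of [a x]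
    modulo [a], where it becomes [X^(m-1) (X + b)] with [m > 2], shows that
    [sigma x = c x + l] with [c] a constant and [l] a linear form of [A].

    So the group consists of affine maps [x |-> c x + l].  Those with [c = 1] form
    an elementary abelian normal Sylow [p]-subgroup; a complement embeds in [K^*]
    by [c], hence is cyclic, and acts freely on the nontrivial translations. *)

Require Import Defs.
From HB Require Import structures.
From mathcomp Require Import all_boot all_order all_algebra all_fingroup all_field all_solvable.
From mathcomp Require Import ring_quotient fraction zify ring.
From mathcomp Require Import boolp classical_sets mpoly.

Set Implicit Arguments.
Unset Strict Implicit.
Unset Printing Implicit Defensive.

Import Order.TTheory GRing.Theory.

Local Open Scope ring_scope.

(** * Integrally closed polynomial rings and the different *)

(** Fractions of [S] are handled inside polynomial rings: vanishing in [S] is [dvds F], integrality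
    of [G / H] is [integral_mod], and membership of [G / H] in [S] is [comb]. The dimension
    hypothesis speaks only of chains of irreducible closed sets in the singular locus, so a
    conductor that is too small has to be refuted by building a long chain: modulo the conductor the
    coordinate ring is integral over a polynomial ring, by Noether normalization, and a flag of
    coordinate primes of that ring is lifted by going up. The factor [a] is needed because the
    equation of [x] over [A] is not monic when [P] lies on [X]; the price is that divisibility of
    the conjugates of [a x] by [a] must then be recovered. The bound d >= 4 ensures m >= 3 in both
    cases, which is what distinguishes the (m-1)-fold root from the simple one. *)

Lemma mpoly_gen_ind (n : nat) (R : nzRingType) (P : {mpoly R[n]} -> Prop) :
  (forall c, P c%:MP) -> (forall i, P 'X_i) ->
  (forall p q, P p -> P q -> P (p + q)) ->
  (forall p q, P p -> P q -> P (p * q)) ->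
  forall p, P p.
Proof.
move=> PC PX PD PM p; rewrite (mpolyE p).
apply: big_ind => [||m _]; first by rewrite -mpolyC0; apply: PC.
  exact: PD.
rewrite -mul_mpolyC; apply: (PM) => //; rewrite mpolyXE_id.
apply: big_ind => [||i _]; first by rewrite -mpolyC1; apply: PC.
  exact: PM.
elim: (m i) => [|k IH]; first by rewrite expr0 -mpolyC1; apply: PC.
by rewrite exprS; apply: PM.
Qed.

Lemma mderiv_var (n : nat) (R : nzRingType) (i j : 'I_n) :
  ('X_i : {mpoly R[n]})^`M(j) = ((i == j)%:R)%:MP.
Proof.
rewrite mderivX mnm1E; case: eqP => [->|_]; last by rewrite scale0r mpolyC0.
rewrite scale1r (_ : (_ - _)%MM = 0%MM) ?mpolyX0 //.
by apply/mnmP => k; rewrite mnmBE subnn mnm0E.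
Qed.

(* Complete integral closedness: [h ^+ k %| e * g ^+ k] for all [k] forces the
   leading monomial of [h] to divide that of [g]; cancel it and iterate. *)
Lemma mpoly_almost_integral (n : nat) (K : fieldType) (e g h : {mpoly K[n]}) :
  e != 0 -> h != 0 -> (forall k, exists c, e * g ^+ k = c * h ^+ k) ->
  exists q, g = q * h.
Proof.
move=> e0 h0; move gm: (mlead g) => m.
elim/(well_founded_ind (@ltom_wf n)): m g gm => m IH g gm div.
have [->|g0] := eqVneq g 0; first by exists 0; rewrite mul0r.
have le_hg : (mlead h <= mlead g)%MM.
  apply/mnm_lepP => i; rewrite leqNgt; apply/negP => lt_gh.
  (* A deficit in the i-th exponent is multiplied by the power taken, while [e] contributes a fixed
     amount; this power is the first one that beats it. *)
  have [c ec] := div (mlead e i).+1.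
  have c0 : c != 0.
    apply/eqP => c0; move/eqP: ec; rewrite c0 mul0r mulf_eq0 expf_eq0 /=.
    by rewrite (negbTE e0) (negbTE g0).
  have := congr1 (fun p => mlead p i) ec.
  rewrite !mleadM ?expf_neq0 // !mleadX // !mnmDE !mulmnE => H.
  have : (mlead g i * (mlead e i).+1 + (mlead e i).+1
          <= mlead h i * (mlead e i).+1)%N.
    by rewrite -mulSnr leq_mul2r lt_gh orbT.
  move: (mlead g i * _)%N (mlead h i * _)%N H => a b H le_ab.
  have : (mlead e i < (mlead e i).+1)%N by [].
  rewrite ltnNge; case/negP; rewrite -(leq_add2l a) (leq_trans le_ab) //.
  by rewrite addnC H leq_addl.
pose u := (mlead g - mlead h)%MM.
pose s : {mpoly K[n]} := (mleadc g / mleadc h) *: 'X_[u].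
have lh0 : mleadc h != 0 by rewrite mleadc_eq0.
have lg0 : mleadc g != 0 by rewrite mleadc_eq0.
have s0 : mleadc g / mleadc h != 0 by rewrite mulf_neq0 ?invr_eq0.
have sh : mlead (s * h) = mlead g.
  rewrite mleadM //; last by rewrite mscalerI (negbTE s0) /= -msize_poly_eq0 msizeX.
  by rewrite /s mleadZ // mleadXm /u submK.
have shc : mleadc (s * h) = mleadc g.
  have -> : s * h = (mleadc g / mleadc h) *: ('X_[u] * h) by rewrite scalerAl.
  by rewrite mleadcZE mleadM // ?mleadcM ?mleadXm ?mcoeffX ?eqxx ?mul1r ?divfK //
             -msize_poly_eq0 msizeX.
have [q gq] : exists q, g - s * h = q * h.
  have [->|gs0] := eqVneq (g - s * h) 0; first by exists 0; rewrite mul0r.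
  have lt_g : (mlead (g - s * h) < mlead g)%O.
    rewrite lt_neqAle; apply/andP; split.
      apply: contra_neq gs0 => eq_l; apply/eqP; rewrite -mleadc_eq0 eq_l.
      by rewrite mcoeffB -{2}sh shc subrr.
    by have := mleadB_le g (s * h); rewrite sh joinxx.
  rewrite gm in lt_g; apply: (IH _ lt_g _ erefl) => k.
  suff [c ec] : exists c, e * (g - s * h) ^+ k = c * h ^+ k by exists c.
  rewrite exprBn mulr_sumr.
  elim/big_ind: _ => [|x y [c1 ->] [c2 ->]|i _].
  - by exists 0; rewrite mul0r.
  - by exists (c1 + c2); rewrite mulrDl.
  have [c ec] := div (k - i)%N.
  exists ((-1) ^+ i * c * s ^+ i *+ 'C(k, i)).
  have -> : h ^+ k = h ^+ (k - i) * h ^+ i.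
    by rewrite -exprD subnK // -ltnS ltn_ord.
  have {c ec} <- : e * g ^+ (k - i) * ((-1) ^+ i * s ^+ i * h ^+ i) *+ 'C(k, i) =
    (-1) ^+ i * c * s ^+ i *+ 'C(k, i) * (h ^+ (k - i) * h ^+ i).
    rewrite ec -mulrnAl; ring.
  rewrite exprMn; ring.
by exists (q + s); rewrite mulrDl -gq subrK.
Qed.

(** All powers of a root of a monic polynomial of degree r are combinations of its first r powers,
    so [h ^+ r] is a common denominator and can serve as [e] in [mpoly_almost_integral]. *)
Lemma rmorph_integral_mpoly (n : nat) (K Om : fieldType)
    (phi : {rmorphism {mpoly K[n]} -> Om}) (g h : {mpoly K[n]}) :
  h != 0 -> injective phi -> integralOver phi (phi g / phi h) ->
  exists q, g = q * h.
Proof.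
move=> h0 injphi [p mp rp]; pose r := (size p).-1.
have ph0 : phi h != 0 by rewrite -(rmorph0 phi) (inj_eq injphi).
apply: (@mpoly_almost_integral _ _ (h ^+ r)) => //; first by rewrite expf_neq0.
move=> k; pose s := Pdiv.Ring.rmodp 'X^k p.
have ss : (size s <= r)%N.
  by rewrite -ltnS /r prednK ?lt0n ?size_poly_eq0 ?monic_neq0 //
     Pdiv.Ring.ltn_rmodpN0 ?monic_neq0.
exists (\sum_(i < r) s`_i * g ^+ i * h ^+ (r - i)); apply: injphi.
have E : (phi g / phi h) ^+ k = (map_poly phi s).[phi g / phi h].
  rewrite -hornerXn -(map_polyXn phi) {1}(Pdiv.RingMonic.rdivp_eq mp 'X^k) rmorphD rmorphM.
  by rewrite hornerD hornerM (rootP rp) mulr0 add0r.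
have {}E : phi g ^+ k = (map_poly phi s).[phi g / phi h] * phi h ^+ k.
  by rewrite -E expr_div_n divfK ?expf_neq0.
rewrite !rmorphM !rmorphXn /= E (horner_coef_wide _ (n := r)); last first.
  by rewrite (leq_trans (size_poly _ _)).
rewrite mulrA; congr (_ * _); rewrite mulr_sumr rmorph_sum; apply: eq_bigr => i _.
rewrite coef_map !rmorphM !rmorphXn /= expr_div_n.
have -> : phi h ^+ r = phi h ^+ (r - i) * phi h ^+ i.
  by rewrite -exprD subnK // ltnW.
by field; rewrite expf_neq0.
Qed.

Lemma splitting_field_exists (F : fieldType) (p : {poly F}) : p \is monic ->
  exists (L : fieldType) (iota : {rmorphism F -> L}) (rs : seq L),
    map_poly iota p = \prod_(r <- rs) ('X - r%:P).
Proof.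
have [m] := ubnP (size p); elim: m F p => // m IH F p lt_pm mp.
have [p1|p1] := eqVneq (size p) 1%N.
  exists F, idfun, [::]; rewrite big_nil map_poly_id //.
  by move/eqP: mp; rewrite lead_coefE p1 /= => pE; rewrite (size1_polyC (eq_leq p1)) pE.
have [q [iq qp]] : exists q : {poly F}, irreducible_poly q /\ q %| p.
  have [k] := ubnP (size p).
  elim: k p {lt_pm IH} p1 mp => // k IHk p p1 mp lt_pk.
  have [ip|nip] := pselect (irreducible_poly p); first by exists p.
  have p_gt1 : (1 < size p)%N.
    by rewrite ltn_neqAle eq_sym p1 lt0n size_poly_eq0 monic_neq0.
  have [q [q1 qp neq]] : exists q : {poly F}, [/\ size q != 1%N, q %| p & ~~ (q %= p)].
    apply: contrapT => H; apply: nip; split=> // q q1 qp.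
    by apply/negPn/negP => qnp; apply: H; exists q.
  have q0 : q != 0 by apply: contraTneq qp => ->; rewrite dvd0p monic_neq0.
  have lq0 : lead_coef q != 0 by rewrite lead_coef_eq0.
  have [||| r [ir rq]] := IHk ((lead_coef q)^-1 *: q).
  - by rewrite size_scale ?invr_eq0.
  - by rewrite monicE lead_coefZ mulVf.
  - rewrite size_scale ?invr_eq0 //.
    have := dvdp_leq (monic_neq0 mp) qp; rewrite leq_eqVlt => /orP[/eqP eq_s|].
      by rewrite -(dvdp_size_eqp qp) eq_s eqxx in neq.
    by move=> lt_qp; apply: leq_trans lt_qp _; rewrite -ltnS.
  exists r; split=> //; apply: dvdp_trans rq _.
  by rewrite dvdpZl ?invr_eq0.
have [L _ [z rz _]] := irredp_FAdjoin iq.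
pose j := GRing.in_alg L.
have rpz : root (map_poly j p) z.
  rewrite root_factor_theorem; apply: dvdp_trans (_ : map_poly j q %| _).
    by rewrite -root_factor_theorem.
  by rewrite dvdp_map.
have [p' E] := factor_theorem _ _ rpz.
have mp' : p' \is monic.
  by have := map_monic j p; rewrite E mp monicMr ?monicXsubC.
have [||L' [iota [rs Ers]]] := IH L p' => //.
  rewrite -(size_map_poly j) E size_Mmonic ?monic_neq0 ?monicXsubC // in lt_pm.
  by move: lt_pm; rewrite size_XsubC addn2 ltnS.
exists L', (iota \o j), (iota z :: rs).
by rewrite map_poly_comp E rmorphM /= Ers big_cons mulrC map_polyXsubC.
Qed.

Lemma dvd_polyC (A : comNzRingType) (k : {poly A}) (h : A) :
  (forall i, exists q, k`_i = q * h) -> exists Q, k = Q * h%:P.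
Proof.
move=> /choice[f kf]; exists (\poly_(i < size k) f i); apply/polyP => i.
rewrite coefMC coef_poly; case: ltnP => [_|le]; first exact: kf.
by rewrite nth_default // mul0r.
Qed.

(** An equation of integral dependence of the fraction [G / H] over the ring modulo [F], multiplied
    by [H ^+ r]. *)
Definition integral_mod (S : comNzRingType) (F G H : S) : Prop :=
  exists r (a : nat -> S) Q,
    G ^+ r + \sum_(i < r) a i * G ^+ i * H ^+ (r - i) = Q * F.

(* Modulo [F = prod (X - r)] one has [F' g = sum_r g(r) prod_(s != r) (X - s)],
   which is built up here one root at a time. *)
Lemma deriv_mod_integral (A : comNzRingType) (Om : fieldType)
    (phi : {rmorphism A -> Om}) (rs : seq Om) (g : {poly Om}) :
  {in rs, forall r, integralOver phi r /\ integralOver phi g.[r]} ->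
  let P := \prod_(r <- rs) ('X - r%:P) in
  exists L u : {poly Om}, [/\ forall i, integralOver phi L`_i,
    (size L <= size rs)%N & P^`() * g = L + u * P].
Proof.
move=> int_rs P.
(* Integrality of the coefficients of [P] is carried along because a multiple of [P] enters the next
   remainder. *)
suff [L [u [iP iL sL E]]] : exists L u : {poly Om},
    [/\ forall i, integralOver phi P`_i, forall i, integralOver phi L`_i,
        (size L <= size rs)%N & P^`() * g = L + u * P] by exists L, u.
rewrite {}/P; elim: rs int_rs => [|r rs IH] int_rs.
  exists 0, 0; rewrite big_nil; split=> [i|i||].
  - by rewrite coef1; case: eqP => _; [apply: integral1|apply: integral0].
  - by rewrite coef0; apply: integral0.
  - by rewrite size_poly0.
  - by rewrite derivC !mul0r addr0.
have [|L [u [iP iL sL E]]] := IH.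
  by move=> s srs; apply: int_rs; rewrite inE srs orbT.
have [ir igr] := int_rs r (mem_head _ _).
set P := \prod_(s <- rs) _ in iP E *.
have [v gv] : exists v, g - g.[r]%:P = v * ('X - r%:P).
  by apply/factor_theorem; rewrite rootE hornerD hornerN hornerC subrr.
have iX (q : {poly Om}) : (forall i, integralOver phi q`_i) ->
    forall i, integralOver phi (('X - r%:P) * q)`_i.
  move=> iq i; rewrite mulrBl coefB coefXM coefCM.
  apply: integral_sub; last exact: integral_mul.
  by case: eqP => _; [apply: integral0|apply: iq].
exists (g.[r] *: P + ('X - r%:P) * L), (v + u); rewrite big_cons -/P.
split=> [|i||]; first exact: iX.
- by rewrite coefD coefZ; apply: integral_add (iX _ iL _); apply: integral_mul.
- rewrite (leq_trans (size_polyD _ _)) // geq_max; apply/andP; split.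
    by rewrite (leq_trans (size_scale_leq _ _)) // size_prod_XsubC.
  have [->|L0] := eqVneq L 0; first by rewrite mulr0 size_poly0.
  by rewrite mulrC size_Mmonic ?monicXsubC // size_XsubC addn2.
rewrite derivM derivXsubC mul1r -mul_polyC.
have -> : g.[r]%:P = g - v * ('X - r%:P) by rewrite -gv subKr.
have -> : (P + ('X - r%:P) * P^`()) * g = P * g + ('X - r%:P) * (P^`() * g) by ring.
by rewrite E; ring.
Qed.

(** In a splitting field, [g = G / h] takes integral values at the roots of [F], so [F^]() *
    g[has a remainder]L[modulo]F[with integral coefficients. Uniqueness of remainders gives]k = h
    L[for the remainder]k[of]F^[() * G]; the coefficients of [L] are thus integral fractions of the
    base, hence polynomials. *)
Lemma deriv_conductor (n : nat) (K : fieldType) (F G : {poly {mpoly K[n]}})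
    (h : {mpoly K[n]}) :
  F \is monic -> h != 0 -> integral_mod F G h%:P ->
  exists Q1 Q2, F^`() * G = Q1 * h%:P + Q2 * F.
Proof.
move=> mF h0 [r [a [Q rel]]].
have [Om [phi [rs [injphi Frs]]]] : exists (Om : fieldType)
    (phi : {rmorphism {mpoly K[n]} -> Om}) (rs : seq Om),
    injective phi /\ map_poly phi F = \prod_(r <- rs) ('X - r%:P).
  pose tf : {rmorphism {mpoly K[n]} -> {fraction {mpoly K[n]}}} := @tofrac _.
  have [|Om [iota [rs Frs]]] := @splitting_field_exists _ (map_poly tf F).
    exact: monic_map.
  exists Om, (iota \o tf), rs; split; last by rewrite -Frs -map_poly_comp.
  by move=> x y /fmorph_inj /eqP; rewrite tofrac_eq => /eqP.
have ph0 : phi h != 0 by rewrite -(rmorph0 phi) (inj_eq injphi).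
pose g := (phi h)^-1 *: map_poly phi G.
have [s srs|L [u [iL sL E]]] := @deriv_mod_integral _ _ phi rs g.
  have Fs : (map_poly phi F).[s] = 0.
    by apply/rootP; rewrite Frs root_prod_XsubC.
  have is_ : integralOver phi s by exists F => //; apply/rootP.
  split=> //.
  (* The equation of [G / h], evaluated at the root [s] of [F]: it is monic, and its coefficients
     are polynomials in the integral element [s]. *)
  pose q := 'X^r + \poly_(i < r) (map_poly phi (a i)).[s].
  have sq : (size (\poly_(i < r) (map_poly phi (a i)).[s]) < size ('X^r : {poly Om}))%N.
    by rewrite size_polyXn ltnS size_poly.
  apply: (@integral_root_monic _ _ phi _ q).
  - by rewrite monicE lead_coefDl // lead_coefXn.
  - rewrite rootE /q hornerD hornerXn horner_poly.
    have := congr1 (fun p => (map_poly phi p).[s]) rel.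
    rewrite rmorphD rmorphXn rmorph_sum !rmorphM hornerD hornerM /= Fs mulr0.
    rewrite horner_exp horner_sum => rel0; rewrite /g hornerZ.
    apply/eqP; apply: (mulfI (expf_neq0 r ph0)); rewrite mulr0 -[RHS]rel0 {rel0} mulrDr.
    rewrite exprMn exprVn mulVKf ?expf_neq0 //; congr (_ + _).
    rewrite mulr_sumr; apply: eq_bigr => i _.
    rewrite !rmorphM !rmorphXn /= map_polyC !hornerM !horner_exp hornerC.
    have -> : phi h ^+ r = phi h ^+ (r - i) * phi h ^+ i.
      by rewrite -exprD subnK // ltnW.
    rewrite exprMn exprVn; move: (expf_neq0 i ph0) (_ ^+ (r - i)) => {}hi w.
    move: (phi h ^+ i) hi => v hi. by field.
  - apply/integral_poly => i; rewrite coefD coefXn coef_poly.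
    apply: integral_add; first by case: eqP => _; [apply: integral1|apply: integral0].
    case: ltnP => _; last exact: integral0.
    apply: integral_horner => //; apply/integral_poly => j; rewrite coef_map.
    exact: integral_id.
pose k := Pdiv.Ring.rmodp (F^`() * G) F.
have kE := Pdiv.RingMonic.rdivp_eq mF (F^`() * G); rewrite -/k in kE.
have kL : map_poly phi k = phi h *: L.
  rewrite -Frs in E.
  have kE' : map_poly phi (F^`() * G) = phi h *: (L + u * map_poly phi F).
    rewrite rmorphM /= -deriv_map -E /g -scalerAr scalerA mulfV // scale1r.
    by [].
  rewrite kE rmorphD rmorphM /= in kE'.
  set q := Pdiv.Ring.rdivp _ F in kE'.
  have kk : map_poly phi k - phi h *: L =
      (phi h *: u - map_poly phi q) * map_poly phi F.
    have -> : map_poly phi k =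
        phi h *: (L + u * map_poly phi F) - map_poly phi q * map_poly phi F.
      by rewrite -kE' addrC addKr.
    rewrite scalerDr mulrBl -scalerAl; move: (_ *: L) (_ *: (u * _)) => x y; ring.
  apply/eqP; rewrite -subr_eq0; apply: contraT => nz.
  have : (size (map_poly phi k - phi h *: L)%R < size (map_poly phi F))%N.
    rewrite (leq_ltn_trans (size_polyD _ _)) // size_polyN gtn_max.
    rewrite !(size_map_inj_poly injphi (rmorph0 phi)).
    rewrite Pdiv.Ring.ltn_rmodpN0 ?monic_neq0 //=.
    rewrite (leq_ltn_trans (size_scale_leq _ _)) // (leq_ltn_trans sL) //.
    by rewrite -(size_map_inj_poly injphi (rmorph0 phi) F) Frs size_prod_XsubC.
  have v0 : phi h *: u - map_poly phi q != 0.
    by apply: contra_neq nz => z; rewrite kk z mul0r.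
  rewrite kk size_Mmonic ?monic_map // ltnNge => /negP[].
  by move: v0; rewrite -size_poly_gt0; case: (size _) => // s _; rewrite leq_addl.
have [Q1 kQ1] : exists Q1, k = Q1 * h%:P.
  apply: dvd_polyC => i; apply: (rmorph_integral_mpoly h0 injphi).
  have -> : phi k`_i / phi h = L`_i; last by [].
  by rewrite -coef_map kL coefZ mulrAC mulfV // mul1r.
exists Q1, (Pdiv.Ring.rdivp (F^`() * G) F).
by rewrite {1}kE kQ1 addrC.
Qed.

Definition dvds (R : comNzRingType) (F G : R) : Prop := exists Q, G = Q * F.

Definition prime_elt (R : comNzRingType) (F : R) : Prop :=
  ~ dvds F 1 /\ forall a b, dvds F (a * b) -> dvds F a \/ dvds F b.

Lemma dvds_mull (R : comNzRingType) (F a b : R) : dvds F b -> dvds F (a * b).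
Proof. by move=> [Q ->]; exists (a * Q); rewrite mulrA. Qed.

Lemma dvdsD (R : comNzRingType) (F a b : R) : dvds F a -> dvds F b -> dvds F (a + b).
Proof. by move=> [P ->] [Q ->]; exists (P + Q); rewrite mulrDl. Qed.

(** The witness is the resultant. If it vanished, [F] and [H] would have a nonconstant common factor
    up to constants; primality would make [F] divide that factor, hence [H]. This later replaces a
    denominator [H] by one in [A]. *)
Lemma monic_prime_elimination (A : idomainType) (F H : {poly A}) :
  F \is monic -> prime_elt F -> ~ dvds F H ->
  exists h u v, h != 0 /\ h%:P = u * F + v * H.
Proof.
move=> mF [nF1 pF] nH.
have sF : (1 < size F)%N.
  rewrite ltn_neqAle lt0n size_poly_eq0 monic_neq0 // andbT eq_sym.
  apply/eqP => sF; apply: nF1; exists 1; rewrite mul1r.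
  by move: (mF); rewrite monicE lead_coefE sF /= => /eqP F0; rewrite (size1_polyC (eq_leq sF)) F0.
have F0 := monic_neq0 mF.
have smallF c : c != 0 -> ~ dvds F c%:P.
  move=> c0 [Q E]; have := congr1 (fun p : {poly A} => size p) E.
  have Q0 : Q != 0 by apply: contra_neq c0 => Q0; apply/eqP; rewrite -polyC_eq0 E Q0 mul0r.
  rewrite size_polyC c0 size_Mmonic //.
  by move: Q0 sF; rewrite -size_poly_gt0 /=; move: (size Q) (size F) => x y; lia.
have [sH|sH] := leqP (size H) 1.
  exists H`_0, 0, 1; rewrite mul0r add0r mul1r -(size1_polyC sH); split=> //.
  apply/eqP => H0; apply: nH; exists 0; by rewrite mul0r (size1_polyC sH) H0.
have [[u v] /= _ E] := resultant_in_ideal sF sH.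
exists (resultant F H), u, v; split=> //; rewrite resultant_eq0 -leqNgt.
set g := gcdp F H; rewrite leqNgt; apply/negP => sg.
have [[c k] /= c0 cF] := Pdiv.Idomain.dvdpP _ _ (dvdp_gcdl F H).
have [[c' k'] /= c'0 cH] := Pdiv.Idomain.dvdpP _ _ (dvdp_gcdr F H).
rewrite -/g in cF cH.
have [[Q kQ]|[Q gQ]] : dvds F k \/ dvds F g.
- by apply: pF; rewrite -cF; exists c%:P; rewrite mul_polyC.
- have : c%:P = Q * g.
    by apply: (mulIf F0); rewrite mul_polyC cF kQ mulrAC.
  move/(congr1 (fun p : {poly A} => size p)); rewrite size_polyC c0.
  have Q0 : Q != 0.
    apply: contra_neq c0 => Q0; move: cF; rewrite kQ Q0 !mul0r => /eqP.
    by rewrite -mul_polyC mulf_eq0 (negbTE F0) orbF polyC_eq0 => /eqP.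
  have g0 : g != 0 by rewrite -size_poly_gt0 (leq_trans _ sg).
  rewrite size_mul //.
  by move: Q0 sg; rewrite -size_poly_gt0 /=; move: (size Q) (size g) => x y; lia.
- have [|/(smallF _ c'0)[]|/nH[]] := pF c'%:P H.
  by rewrite mul_polyC cH gQ; exists (k' * Q); rewrite mulrA.
Qed.

(** Subtracting from [b] the quotient of [a] by [al], times [be], leaves a multiple of [al] equal to
    [be] times a remainder modulo [al], which is zero for degree reasons. *)
Lemma monic_const_regular (C : idomainType) (al : {poly C}) (be : C) (a b : {poly C}) :
  al \is monic -> al * b = be%:P * a -> exists q, b = be%:P * q.
Proof.
move=> mal E; pose q := Pdiv.Ring.rdivp a al; pose r := Pdiv.Ring.rmodp a al.
have aE : a = q * al + r := Pdiv.RingMonic.rdivp_eq mal a.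
exists q; apply/eqP; rewrite -subr_eq0; apply: contraT => nz.
have rE : (b - be%:P * q) * al = be%:P * r.
  by rewrite mulrBl mulrC E {1}aE; ring.
have : (size (be%:P * r)%R < size al)%N.
  rewrite mul_polyC (leq_ltn_trans (size_scale_leq _ _)) //.
  by rewrite Pdiv.Ring.ltn_rmodpN0 ?monic_neq0.
rewrite -rE size_Mmonic // ltnNge => /negP[].
by move: nz; rewrite -size_poly_gt0; case: (size _) => // s _; rewrite leq_addl.
Qed.

(* Serre's criterion in the case at hand: [A[X]/F] is free over [A], so a
   fraction [G / h] cleared by a regular pair of [A] has numerator in [(h, F)]. *)
Lemma regular_pair_clears (A : idomainType) (F G : {poly A}) (h al be : A) :
  F \is monic -> h != 0 -> be != 0 ->
  (forall a b, al * b = be * a -> exists q, b = be * q) ->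
  (exists P Q, al%:P * G = P * h%:P + Q * F) ->
  (exists P Q, be%:P * G = P * h%:P + Q * F) ->
  exists P Q, G = P * h%:P + Q * F.
Proof.
move=> mF h0 be0 reg alG beG; pose r := Pdiv.Ring.rmodp G F.
have GE : G = Pdiv.Ring.rdivp G F * F + r := Pdiv.RingMonic.rdivp_eq mF G.
have clear c : (exists P Q, c%:P * G = P * h%:P + Q * F) ->
    forall i, exists a, c * r`_i = h * a.
  move=> [P [Q E]] i; exists (Pdiv.Ring.rmodp P F)`_i.
  have := congr1 (fun p => (Pdiv.Ring.rmodp p F)`_i) E.
  rewrite Pdiv.RingMonic.rmodpD // Pdiv.RingMonic.rmodp_mull // addr0 mulrC.
  by rewrite ![_ * _%:P]mulrC !mul_polyC !Pdiv.RingMonic.rmodpZ // !coefZ.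
have [P rP] : exists P, r = P * h%:P.
  apply: dvd_polyC => i; have [a ea] := clear _ alG i; have [b eb] := clear _ beG i.
  (* From [al r_i = h a] and [be r_i = h b] follows [al b = be a], and [b = be q] then gives
     [r_i = h q]. *)
  have [|q bq] := reg a b.
    apply: (mulfI h0); rewrite mulrCA -eb [RHS]mulrCA -ea; ring.
  exists q; apply: (mulfI be0); rewrite eb bq; ring.
by exists P, (Pdiv.Ring.rdivp G F); rewrite {1}GE rP addrC.
Qed.

(** * Going up, points, and chains of irreducible closed sets *)

Record is_ideal (R : comNzRingType) (I : set R) : Prop := IsIdeal {
  ideal0 : I 0;
  idealD : forall x y, I x -> I y -> I (x + y);
  ideal_mull : forall a x, I x -> I (a * x)
}.

Record prime_ideal (R : comNzRingType) (P : set R) : Prop := PrimeIdeal {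
  prime_is_ideal : is_ideal P;
  prime_proper : ~ P 1;
  prime_mul : forall x y, P (x * y) -> P x \/ P y
}.

Section IdealTheory.
Variables (R : comNzRingType) (I : set R) (hI : is_ideal I).

Lemma idealN x : I x -> I (- x).
Proof. by move=> Ix; rewrite -mulN1r; apply: ideal_mull. Qed.

Lemma idealB x y : I x -> I y -> I (x - y).
Proof. by move=> Ix Iy; apply: idealD => //; apply: idealN. Qed.

Lemma ideal_mulr x a : I x -> I (x * a).
Proof. by rewrite mulrC; apply: ideal_mull. Qed.

Lemma ideal_sum (J : Type) (r : seq J) (S : pred J) (f : J -> R) :
  (forall j, S j -> I (f j)) -> I (\sum_(j <- r | S j) f j).
Proof. by move=> If; apply: big_ind => //; [apply: ideal0|apply: idealD]. Qed.

Lemma ideal_equiv x y : I (x - y) -> I y -> I x.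
Proof. by move=> Ixy Iy; rewrite -(subrK y x); apply: idealD. Qed.

End IdealTheory.

Definition ideal_adjoin (R : comNzRingType) (I : set R) (x : R) : set R :=
  fun y => exists p a, I p /\ y = p + a * x.

Lemma ideal_adjoin_ideal (R : comNzRingType) (I : set R) (x : R) :
  is_ideal I -> is_ideal (ideal_adjoin I x).
Proof.
move=> hI; split.
- by exists 0, 0; rewrite mul0r addr0; split=> //; apply: ideal0.
- move=> _ _ [p [a [Ip ->]]] [q [b [Iq ->]]]; exists (p + q), (a + b).
  by split; [apply: idealD|rewrite mulrDl addrACA].
- move=> c _ [p [a [Ip ->]]]; exists (c * p), (c * a).
  by split; [apply: ideal_mull|rewrite mulrDr mulrA].
Qed.

Lemma prime_pow (R : comNzRingType) (P : set R) (x : R) k :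
  prime_ideal P -> P (x ^+ k) -> P x.
Proof.
move=> pP; elim: k => [|k IH]; first by rewrite expr0 => /(prime_proper pP).
by rewrite exprS => /(prime_mul pP)[|/IH].
Qed.

Lemma maximal_avoiding_prime (R : comNzRingType) (I W : set R) :
  is_ideal I -> W 1 -> (forall a b, W a -> W b -> W (a * b)) ->
  (forall a, I a -> ~ W a) ->
  exists P, [/\ prime_ideal P, forall a, I a -> P a, forall a, P a -> ~ W a
    & forall x, ~ P x -> exists a, ideal_adjoin P x a /\ W a].
Proof.
move=> hI W1 WM IW.
pose good (J : set R) := is_ideal J /\ forall a, J a -> ~ W a.
(* The property is put on the union with [I], so that it also holds for the union of the empty
   chain. *)
have [|J [gJ maxJ]] := @Zorn_bigcup R (fun J => good (I `|` J)%classic).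
  move=> F Fgood Ftot; split; last first.
    by move=> a [/IW//|[X FX Xa]]; apply: (Fgood X FX).2; right.
  have mem x y : (I `|` \bigcup_(X in F) X)%classic x ->
      (I `|` \bigcup_(X in F) X)%classic y ->
      (I x /\ I y) \/ exists X, [/\ F X, (I `|` X)%classic x & (I `|` X)%classic y].
    case=> [Ix|[X FX Xx]] [Iy|[Y FY Yy]]; first by left.
    - by right; exists Y; split=> //; [left|right].
    - by right; exists X; split=> //; [right|left].
    - have [XY|YX] := Ftot X Y FX FY; right.
        by exists Y; split=> //; right=> //; apply: XY.
      by exists X; split=> //; right=> //; apply: YX.
  have lift X x : F X -> (I `|` X)%classic x -> (I `|` \bigcup_(X in F) X)%classic x.
    by move=> FX [Ix|Xx]; [left|right; exists X].
  split; first by left; apply: ideal0.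
  - move=> x y Ux Uy; have [[Ix Iy]|[X [FX Xx Xy]]] := mem x y Ux Uy.
      by left; apply: idealD.
    exact: lift FX (idealD (Fgood X FX).1 Xx Xy).
  - move=> a x Ux; have [[Ix _]|[X [FX Xx _]]] := mem x x Ux Ux.
      by left; apply: ideal_mull.
    exact: lift FX (ideal_mull (Fgood X FX).1 a Xx).
set P := (I `|` J)%classic in gJ maxJ; have [hP PW] := gJ.
have maxP x : ~ P x -> exists a, ideal_adjoin P x a /\ W a.
  move=> nPx; apply: contrapT => H.
  have hQ := ideal_adjoin_ideal x hP.
  have PQ a : P a -> ideal_adjoin P x a.
    by move=> Pa; exists a, 0; rewrite mul0r addr0.
  have Qx : ideal_adjoin P x x.
    by exists 0, 1; rewrite mul1r add0r; split=> //; apply: ideal0.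
  apply: (maxJ (ideal_adjoin P x)).
    split; first by move=> a Ja; apply: PQ; right.
    by move=> /(_ x Qx) Jx; apply: nPx; right.
  have -> : (I `|` ideal_adjoin P x)%classic = ideal_adjoin P x.
    by apply/seteqP; split=> a; [case=> // Ia; apply: PQ; left|right].
  by split=> // a Qa Wa; apply: H; exists a.
exists P; split=> //; last by move=> a Ia; left.
split=> //; first by move=> /PW.
move=> x y Pxy; apply: contrapT => /not_orP[/maxP[_ [[p [a [Pp ->]]] Wp]]].
move=> /maxP[_ [[q [b [Pq ->]]] Wq]].
apply: (PW _ _ (WM _ _ Wp Wq)).
have -> : (p + a * x) * (q + b * y) =
  p * (q + b * y) + (a * x) * q + a * b * (x * y) by ring.
by apply: (idealD hP); [apply: (idealD hP); [exact: ideal_mulr|exact: ideal_mull]|exact: ideal_mull].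
Qed.

(** Integrality over [A] of the class of [h] in [R / I], stated without forming the quotient, so
    that [I] may be enlarged freely. *)
Definition integral_over_mod (A R : comNzRingType) (phi : A -> R) (I : set R) (h : R) :=
  exists p : {poly A}, p \is monic /\ I (map_poly phi p).[h].

(* Take [P'] maximal among the ideals containing [P] and disjoint from
   [phi (A \ Q)]; integrality forces [Q] into its contraction. *)
Lemma going_up (A R : comNzRingType) (phi : {rmorphism A -> R}) (P : set R) (Q : set A) :
  is_ideal P -> (forall h, integral_over_mod phi P h) ->
  prime_ideal Q -> (forall a, P (phi a) -> Q a) ->
  exists P', [/\ prime_ideal P', forall x, P x -> P' x & forall a, P' (phi a) <-> Q a].
Proof.
move=> hP int pQ PQ.
pose W : set R := fun x => exists2 a, ~ Q a & x = phi a.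
have [||| P' [pP' PP' P'W maxP']] := @maximal_avoiding_prime R P W hP.
- by exists 1; [exact: prime_proper|rewrite rmorph1].
- move=> _ _ [a Qa ->] [b Qb ->]; exists (a * b); last by rewrite rmorphM.
  by move=> /(prime_mul pQ)[].
- by move=> x Px [a nQa xE]; apply: nQa; apply: PQ; rewrite -xE.
have hP' := prime_is_ideal pP'.
exists P'; split=> // a; split=> [P'a|Qa].
  by apply: contrapT => nQa; apply: (P'W _ P'a); exists a.
apply: contrapT => /maxP'[_ [[p [h [P'p ->]]] [b nQb E]]].
have [c [mc Pc]] := int h.
pose r := (size c).-1.
have sc : size c = r.+1 by rewrite prednK // size_poly_gt0 monic_neq0.
have cr : c`_r = 1 by move: mc; rewrite monicE => /eqP.
have hQ := prime_is_ideal pQ.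
(* Homogenize the equation of [h] by [a]: since [h * phi a] is [phi b] modulo [P'], the sum maps
   into [P'], whose contraction lies in [Q]. All terms but [b ^+ r] contain [a], which is in [Q], so
   [b] is in [Q] as well. *)
have Q1 : Q (\sum_(i < r.+1) c`_i * a ^+ (r - i) * b ^+ i).
  apply: contrapT => nQ; apply: (P'W (phi (\sum_(i < r.+1) c`_i * a ^+ (r - i) * b ^+ i))); last by exists (\sum_(i < r.+1) c`_i * a ^+ (r - i) * b ^+ i).
  apply: (ideal_equiv hP' _ (ideal_mull hP' (phi a ^+ r) (PP' _ Pc))).
  rewrite (horner_coef_wide _ (n := r.+1)) ?(leq_trans (size_poly _ _)) ?sc //.
  rewrite mulr_sumr rmorph_sum -sumrB; apply: ideal_sum => // i _.
  rewrite coef_map !rmorphM !rmorphXn /=.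
  have -> : phi a ^+ r = phi a ^+ (r - i) * phi a ^+ i.
    by rewrite -exprD subnK // -ltnS.
  have -> : phi c`_i * phi a ^+ (r - i) * phi b ^+ i -
      phi a ^+ (r - i) * phi a ^+ i * (phi c`_i * h ^+ i) =
      phi c`_i * phi a ^+ (r - i) * (phi b ^+ i - (h * phi a) ^+ i).
    rewrite exprMn; ring.
  by apply: ideal_mull => //; rewrite subrXX; apply: ideal_mulr; rewrite // -E addrK.
apply: nQb; apply: (prime_pow (k := r)) => //.
move: Q1; rewrite big_ord_recr /= cr mul1r subnn expr0 mul1r => Q1.
rewrite -[b ^+ r](addKr (\sum_(i < r) c`_i * a ^+ (r - i) * b ^+ i)).
apply: idealD => //; apply: idealN => //; apply: ideal_sum => // i _.
apply: ideal_mulr => //; apply: ideal_mull => //.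
by rewrite -[(r - i)%N]prednK ?subn_gt0 // exprS; apply: ideal_mulr.
Qed.

Record proper_ideal_set (R : comNzRingType) := ProperIdealSet {
  ideal_set :> set R;
  ideal_setP : is_ideal ideal_set;
  ideal_set1 : ~ ideal_set 1
}.

Section QuotientIntegrality.
Variables (R : comNzRingType) (I : proper_ideal_set R).

Definition ideal_mem : {pred R} := fun x => `[< ideal_set I x >].

Lemma ideal_mem_closed : idealr_closed ideal_mem.
Proof.
have hI := ideal_setP I; split.
- by apply/asboolP; apply: ideal0.
- by apply/asboolP; apply: ideal_set1.
- move=> a u v /asboolP Iu /asboolP Iv; apply/asboolP.
  by apply: idealD => //; apply: ideal_mull.
Qed.

HB.instance Definition _ := isIdealr.Build R ideal_mem ideal_mem_closed.

Lemma ideal_quotient : exists (Q : comNzRingType) (f : {rmorphism R -> Q}),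
  forall x, f x = 0 <-> ideal_set I x.
Proof.
exists {ideal_quot ideal_mem}, \pi_({ideal_quot ideal_mem})%qT => x.
have -> : 0 = \pi_({ideal_quot ideal_mem})%qT 0 :> {ideal_quot ideal_mem}.
  by rewrite rmorph0.
by split=> [/eqP|Ix]; last apply/eqP;
   rewrite -Quotient.idealrBE subr0; [move/asboolP|apply/asboolP].
Qed.

End QuotientIntegrality.

Section IntegralOverMod.
Variables (A R : comNzRingType) (phi : {rmorphism A -> R}) (I : set R).
Hypothesis hI : is_ideal I.

(** Transfers the closure properties of integral elements from the quotient ring. The unit ideal is
    set apart because the quotient must be a nonzero ring. *)
Lemma integral_over_mod_quot : I 1 \/ exists (Q : comNzRingType) (f : {rmorphism R -> Q}),
  (forall x, f x = 0 <-> I x) /\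
  forall x, integral_over_mod phi I x <-> integralOver (f \o phi) (f x).
Proof.
have [I1|nI1] := pselect (I 1); [by left|right].
have [Q [f fI]] := ideal_quotient (ProperIdealSet hI nI1).
exists Q, f; split=> // x; split=> [[p [mp Ip]]|[p mp rp]]; exists p => //.
  by rewrite map_poly_comp rootE horner_map; apply/eqP/fI.
by split=> //; apply/fI; move: rp; rewrite map_poly_comp rootE horner_map => /eqP.
Qed.

Lemma integral_over_mod_root (p : {poly R}) (x : R) : p \is monic ->
  I p.[x] -> (forall i, integral_over_mod phi I p`_i) -> integral_over_mod phi I x.
Proof.
move=> mp Ipx intp; have [I1|[Q [f [fI intE]]]] := integral_over_mod_quot.
  by exists 1; split; [apply: monic1|rewrite rmorph1 hornerC].
apply/intE; apply: (@integral_root_monic _ _ (f \o phi) _ (map_poly f p)).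
- exact: monic_map.
- by rewrite rootE horner_map; apply/eqP/fI.
- by apply/integral_poly => i; rewrite coef_map; apply/intE.
Qed.

Lemma integral_over_mod_base a : integral_over_mod phi I (phi a).
Proof.
exists ('X - a%:P); split; first exact: monicXsubC.
by rewrite horner_map hornerXsubC subrr rmorph0; apply: ideal0.
Qed.

Lemma integral_over_modD x y : integral_over_mod phi I x ->
  integral_over_mod phi I y -> integral_over_mod phi I (x + y).
Proof.
have [I1|[Q [f [_ intE]]]] := integral_over_mod_quot.
  by exists 1; split; [apply: monic1|rewrite rmorph1 hornerC].
by move=> /intE ix /intE iy; apply/intE; rewrite rmorphD; apply: integral_add.
Qed.

Lemma integral_over_modM x y : integral_over_mod phi I x ->
  integral_over_mod phi I y -> integral_over_mod phi I (x * y).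
Proof.
have [I1|[Q [f [_ intE]]]] := integral_over_mod_quot.
  by exists 1; split; [apply: monic1|rewrite rmorph1 hornerC].
by move=> /intE ix /intE iy; apply/intE; rewrite rmorphM; apply: integral_mul.
Qed.

End IntegralOverMod.

Lemma integral_over_mod_mono (A R : comNzRingType) (phi : A -> R) (I J : set R) h :
  (forall x, I x -> J x) -> integral_over_mod phi I h -> integral_over_mod phi J h.
Proof. by move=> IJ [p [mp Ip]]; exists p; split=> //; apply: IJ. Qed.

(** * Splitting off the last variable *)

Local Notation wid := (widen_ord (leqnSn _)).

Lemma ord_last_or_widen n (i : 'I_n.+1) : i = ord_max \/ exists j : 'I_n, i = wid j.
Proof.
case: (unliftP ord_max i) => [j ->|->]; [right|by left].
by exists j; apply/val_inj; rewrite /= /bump leqNgt ltn_ord.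
Qed.

Section MuniTheory.
Variables (n : nat) (R : idomainType).
Implicit Types (p q : {mpoly R[n.+1]}) (P Q : {poly {mpoly R[n]}}).

Lemma muniX_widen (i : 'I_n) : muni ('X_(wid i) : {mpoly R[n.+1]}) = ('X_i)%:P.
Proof.
rewrite muniE msuppX big_seq1 mcoeffX eqxx scale1r mnm1E.
have -> : wid i == ord_max = false by rewrite -val_eqE /= ltn_eqF.
rewrite -mul_polyC mulr1; congr (_%:P); congr 'X_[_].
by apply/mnmP => j; rewrite mnmE !mnm1E -!val_eqE.
Qed.

Lemma muniX_last : muni ('X_ord_max : {mpoly R[n.+1]}) = 'X.
Proof.
rewrite muniE msuppX big_seq1 mcoeffX eqxx scale1r mnm1E eqxx expr1.
rewrite (_ : [multinom _ | _ < _] = 0%MM) ?mpolyX0 ?scale1r //.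
apply/mnmP => j; rewrite mnmE mnm0E mnm1E -val_eqE /=.
by rewrite gtn_eqF.
Qed.

Lemma mwidenX_widen (i : 'I_n) : mwiden ('X_i : {mpoly R[n]}) = 'X_(wid i).
Proof. by rewrite mwidenX mnmwiden1. Qed.

Lemma muni_mwiden (p : {mpoly R[n]}) : muni (mwiden p) = p%:P.
Proof.
elim/mpoly_gen_ind: p => [c|i|p q IHp IHq|p q IHp IHq].
- by rewrite mwidenC muniC.
- by rewrite mwidenX_widen muniX_widen.
- by rewrite !rmorphD /= IHp IHq.
- by rewrite !rmorphM /= IHp IHq.
Qed.

Definition of_muni P : {mpoly R[n.+1]} := (map_poly (@mwiden n R) P).['X_ord_max].

Lemma of_muniD : {morph of_muni : P Q / P + Q}.
Proof. by move=> P Q; rewrite /of_muni rmorphD hornerD. Qed.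

Lemma of_muniM : {morph of_muni : P Q / P * Q}.
Proof. by move=> P Q; rewrite /of_muni rmorphM hornerM. Qed.

Lemma of_muni_zmod : zmod_morphism of_muni.
Proof. by move=> P Q; rewrite /of_muni rmorphB hornerD hornerN. Qed.

Lemma of_muni_monoid : monoid_morphism of_muni.
Proof.
split; first by rewrite /of_muni rmorph1 hornerC.
exact: of_muniM.
Qed.

HB.instance Definition _ := GRing.isZmodMorphism.Build _ _ of_muni of_muni_zmod.
HB.instance Definition _ := GRing.isMonoidMorphism.Build _ _ of_muni of_muni_monoid.

Lemma of_muniC (p : {mpoly R[n]}) : of_muni p%:P = mwiden p.
Proof. by rewrite /of_muni map_polyC hornerC. Qed.

Lemma of_muniX : of_muni 'X = 'X_ord_max.
Proof. by rewrite /of_muni map_polyX hornerX. Qed.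

Lemma muniK : cancel (@muni n R) of_muni.
Proof.
move=> p; elim/mpoly_gen_ind: p => [c|i|p q IHp IHq|p q IHp IHq].
- by rewrite muniC of_muniC mwidenC.
- have [->|[j ->]] := ord_last_or_widen i; first by rewrite muniX_last of_muniX.
  by rewrite muniX_widen of_muniC mwidenX_widen.
- by rewrite muniD of_muniD; congr (_ + _).
- by rewrite muniM of_muniM; congr (_ * _).
Qed.

Lemma of_muniK : cancel of_muni (@muni n R).
Proof.
elim/poly_ind => [|P c IH]; first by rewrite /of_muni map_poly0 horner0 muni0.
by rewrite of_muniD of_muniM muniD muniM IH of_muniX of_muniC muniX_last muni_mwiden.
Qed.

Lemma meval_muni (w : 'I_n.+1 -> R) p :
  p.@[w] = (map_poly (meval (fun i => w (wid i))) (muni p)).[w ord_max].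
Proof.
elim/mpoly_gen_ind: p => [c|i|p q IHp IHq|p q IHp IHq].
- by rewrite muniC map_polyC hornerC /= !mevalC.
- have [->|[j ->]] := ord_last_or_widen i.
    by rewrite muniX_last map_polyX hornerX mevalXU.
  by rewrite muniX_widen map_polyC hornerC /= !mevalXU.
- by rewrite !rmorphD /= hornerD IHp IHq.
- by rewrite !rmorphM /= hornerM IHp IHq.
Qed.

Lemma coef_muni p i : (muni p)`_i = \sum_(m <- msupp p | m ord_max == i)
   p@_m *: 'X_[[multinom m (wid j) | j < n]].
Proof.
rewrite muniE coef_sum [RHS]big_mkcond /=; apply: eq_bigr => m _.
rewrite coefZ coefXn eq_sym; case: eqP => _; first by rewrite mulr1.
by rewrite mulr0.
Qed.

Lemma mdeg_split (m : 'X_{1..n.+1}) :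
  mdeg m = (mdeg [multinom m (wid j) | j < n] + m ord_max)%N.
Proof.
rewrite !mdegE big_ord_recr /=; congr (_ + _)%N.
by apply: eq_bigr => j _; rewrite mnmE.
Qed.

Lemma muni_homog d p i : p \is d.-homog -> (muni p)`_i \is (d - i).-homog.
Proof.
move=> /dhomogP hp; rewrite coef_muni big_seq_cond.
apply: rpred_sum => m /andP[mp /eqP mi]; apply: rpredZ; rewrite dhomogX /=.
by rewrite -mi -(hp m mp) /= mdeg_split addnK.
Qed.

Lemma size_muni_homog d p : p \is d.-homog -> (size (muni p) <= d.+1)%N.
Proof.
move=> /dhomogP hp; apply/leq_sizeP => j lt_dj; rewrite coef_muni big_seq_cond.
rewrite big1 // => m /andP[mp /eqP mi].
by have := hp m mp; rewrite /= mdeg_split mi => E; move: lt_dj; rewrite -E ltnNge leq_addl.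
Qed.

Lemma dhomog0_const k (p : {mpoly R[k]}) : p \is 0.-homog -> p = (p@_0%MM)%:MP.
Proof.
move=> hp; apply/mpolyP => m; rewrite mcoeffC; have [->|m0] := eqVneq m 0%MM.
  by rewrite mulr1.
by rewrite mulr0; apply: dhomog_nemf_coeff hp _; rewrite /= mdeg_eq0.
Qed.

Lemma dhomog_at0 k d (p : {mpoly R[k]}) : p \is d.-homog -> (0 < d)%N ->
  p.@[fun=> 0] = 0.
Proof.
move=> /dhomogP hp d0; rewrite mevalE big_seq big1 // => m /hp /= md.
suff [i mi] : exists i, m i != 0%N.
  by rewrite (bigD1 i) //= expr0n (negbTE mi) mul0r mulr0.
apply: contrapT => H; move: d0; rewrite -md mdegE big1 // => i _.
by apply/eqP/negPn/negP => mi; apply: H; exists i.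
Qed.

Definition last_point : 'I_n.+1 -> R := fun i => (i == ord_max)%:R.

(** The coefficients of lower powers of the last variable are forms of positive degree in the
    others, so they vanish at the last coordinate point. *)
Lemma meval_last_point d p : p \is d.-homog -> ((muni p)`_d) = (p.@[last_point])%:MP.
Proof.
move=> hp; have := muni_homog d hp; rewrite subnn => /dhomog0_const E.
rewrite {1}E; congr (_%:MP); rewrite meval_muni.
have -> : last_point ord_max = 1 by rewrite /last_point eqxx.
rewrite (horner_coef_wide _ (n := d.+1)); last first.
  by rewrite (leq_trans (size_poly _ _)) // size_muni_homog.
rewrite big_ord_recr /= expr1n mulr1 coef_map /= big1 => [|i _].
  rewrite add0r {2}E mevalC //.
rewrite coef_map /= expr1n mulr1.
rewrite (meval_eq (v2 := fun=> 0)) => [|j]; last first.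
  by rewrite /last_point -val_eqE /= ltn_eqF.
by apply: (dhomog_at0 (muni_homog i hp)); rewrite subn_gt0.
Qed.

Lemma muni_deriv p : muni p^`M(ord_max) = (muni p)^`().
Proof.
elim/mpoly_gen_ind: p => [c|i|p q IHp IHq|p q IHp IHq].
- by rewrite mderivC muniC derivC muni0.
- have [->|[j ->]] := ord_last_or_widen i.
    by rewrite muniX_last derivX mderiv_var eqxx mpolyC1 muni1.
  rewrite muniX_widen derivC mderiv_var.
  have -> : wid j == ord_max = false by rewrite -val_eqE /= ltn_eqF.
  by rewrite mpolyC0 muni0.
- rewrite mderivD (muniD p^`M(_)) (muniD p) derivD.
  by congr (_ + _); [exact: IHp|exact: IHq].
- rewrite mderivM (muniD (p^`M(_) * q)) (muniM p^`M(_)) !(muniM p) derivM.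
  by congr (_ * _ + _ * _); [exact: IHp|exact: IHq].
Qed.

End MuniTheory.

Lemma dhomog_bigprod (n k : nat) (R : comNzRingType) (d : 'I_n -> nat)
    (f : 'I_n -> {mpoly R[k]}) :
  (forall i, f i \is (d i).-homog) -> \prod_i f i \is (\sum_i d i).-homog.
Proof.
move=> hf; elim/big_rec2: _ => [|i p e _ he]; first exact: dhomog1.
exact: dhomogM.
Qed.

Lemma dhomog_comp (n k m : nat) (R : comNzRingType) (lp : n.-tuple {mpoly R[k]}) g :
  (forall i, tnth lp i \is 1.-homog) -> g \is m.-homog -> g \mPo lp \is m.-homog.
Proof.
move=> hlp /dhomogP hg; rewrite comp_mpolyEX big_seq; apply: rpred_sum => u ug.
apply: rpredZ; rewrite comp_mpolyX -(hg u ug) /= mdegE.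
by apply: dhomog_bigprod => i; have := dhomogMn (u i) (hlp i); rewrite mul1n.
Qed.

Lemma mwiden_homog (n d : nat) (R : idomainType) (p : {mpoly R[n]}) :
  p \is d.-homog -> mwiden p \is d.-homog.
Proof.
move=> hp; rewrite -[mwiden p]/(mmap _ _ p).
have -> : mmap (@mpolyC n.+1 R) (fun i => 'X_(wid i)) p =
   p \mPo [tuple 'X_(wid i) | i < n].
  by apply: eq_bigr => m _; congr (_ * _); apply: eq_bigr => i _; rewrite tnth_mktuple.
by apply: dhomog_comp hp => i; rewrite tnth_mktuple dhomogX /= mdeg1.
Qed.

Lemma mpoly_nonvanishing (K : closedFieldType) (n : nat) (p : {mpoly K[n]}) :
  p != 0 -> exists v, p.@[v] != 0.
Proof.
elim: n p => [|n IH] p p0.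
  exists (fun=> 0); apply: contra_neq p0 => E.
  by rewrite (nvar0_mpolyC p) in E *; move: E; rewrite mevalC => ->.
have mp0 : muni p != 0.
  by apply: contra_neq p0 => E; rewrite -[p]muniK E /of_muni map_poly0 horner0.
have [|v hv] := IH (lead_coef (muni p)); first by rewrite lead_coef_eq0.
have [|x hx] := closed_nonrootP (map_poly (meval v) (muni p)) _.
  apply: contra_neq hv => E; have := congr1 (fun q : {poly K} => q`_(size (muni p)).-1) E.
  by rewrite coef_map coef0.
exists (fun i => if unlift ord_max i is Some j then v j else x).
rewrite meval_muni unlift_none; apply: contra_neqT hx => /negPn/rootP <-.
congr (_.[_]); apply: eq_map_poly => q; apply: meval_eq => i.
case: unliftP => [j|] E; first by congr v; apply/val_inj; have := congr1 val E; rewrite /= /bump leqNgt ltn_ord.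
by have := congr1 val E; rewrite /= => F; have := ltn_ord i; rewrite F ltnn.
Qed.

Lemma prime_ideal_prod (R : comNzRingType) (P : set R) (T : Type) (r : seq T) (f : T -> R) :
  prime_ideal P -> P (\prod_(i <- r) f i) -> exists i, P (f i).
Proof.
move=> pP; elim: r => [|i r IH]; first by rewrite big_nil => /(prime_proper pP).
by rewrite big_cons => /(prime_mul pP)[|//]; exists i.
Qed.

Lemma ker_prime (R : comNzRingType) (S : idomainType) (f : {rmorphism R -> S}) :
  prime_ideal (fun x => f x = 0).
Proof.
split; [split=> [|x y|a x]|rewrite rmorph1|move=> x y].
- by rewrite rmorph0.
- by rewrite rmorphD => -> ->; rewrite addr0.
- by rewrite rmorphM => ->; rewrite mulr0.
- by move/eqP; rewrite oner_eq0.
- by rewrite rmorphM => /eqP; rewrite mulf_eq0 => /orP[]/eqP; [left|right].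
Qed.

(** * Points of a prime that is integral over a polynomial ring *)

Section Points.
Variables (K : closedFieldType) (N m : nat).
Variables (phi : {rmorphism {mpoly K[m]} -> {mpoly K[N]}}).
Hypothesis phiC : forall c, phi c%:MP = c%:MP.
Variables (P : set {mpoly K[N]}).
Hypothesis pP : prime_ideal P.

(** Constant coefficients lying in [P] can be stripped and a factor [f] cancelled, until a constant
    coefficient outside [P] is exposed; it is a multiple of [f] modulo [P]. A point where [phi g]
    does not vanish will then be one where [f] does not vanish. *)
Lemma contracted_multiple (f : {mpoly K[N]}) (p : {poly {mpoly K[m]}}) :
  ~ P f -> (exists i, ~ P (phi p`_i)) -> P (map_poly phi p).[f] ->
  exists g a, ~ P (phi g) /\ P (phi g - a * f).
Proof.
move=> nf; elim/poly_ind: p => [|p c IH] [i].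
  by rewrite coef0 rmorph0 => /(_ (ideal0 (prime_is_ideal pP))).
rewrite rmorphD rmorphM /= map_polyX map_polyC /= hornerMXaddC => hi Pf.
have [Pc|nPc] := pselect (P (phi c)); last first.
  exists c, (- (map_poly phi p).[f]); split=> //.
  by rewrite mulNr opprK addrC.
apply: IH; last first.
  suff /(prime_mul pP)[//|/nf//] : P ((map_poly phi p).[f] * f).
  by rewrite -[_ * f](addrK (phi c)); apply: (idealB (prime_is_ideal pP)).
case: i hi => [|i]; rewrite coefD coefMX coefC /=; first by rewrite add0r.
by rewrite addr0; exists i.
Qed.

(* Going up to the ideal of a point of the base produces a prime modulo which
   every variable is a constant. *)
Lemma nullstellensatz (f : {mpoly K[N]}) :
  (forall h, integral_over_mod phi P h) ->
  (forall g, ~ P (phi g) ->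
     exists z, g.@[z] != 0 /\ forall q, P (phi q) -> q.@[z] = 0) ->
  ~ P f -> exists v, f.@[v] != 0 /\ forall G, P G -> G.@[v] = 0.
Proof.
move=> int pts nf; have hP := prime_is_ideal pP.
have [p [mp Pp]] := int f.
have [|g [a [ng Pga]]] := contracted_multiple nf _ Pp.
  exists (size p).-1; rewrite -lead_coefE (eqP mp) rmorph1.
  exact: prime_proper.
have [z [gz Pz]] := pts g ng.
have [P' [pP' PP' P'z]] := going_up hP int (ker_prime (meval z)) Pz.
have hP' := prime_is_ideal pP'.
have modz q : P' (phi q - (q.@[z])%:MP).
  by rewrite -phiC -rmorphB; apply/P'z; rewrite /= rmorphB /= mevalC subrr.
(* Modulo [P'] the integral equation of a variable has coefficients in [K], hence splits into linear
   factors, one of which lies in the prime [P']. *)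
have : forall i, exists c, P' ('X_i - c%:MP).
  move=> i; have [q [mq Pq]] := int 'X_i.
  have [rs qE] := closed_field_poly_normal (map_poly (meval z) q).
  have mq' : map_poly (meval z) q \is monic by apply: monic_map.
  rewrite (eqP mq') scale1r in qE.
  have : P' (map_poly (@mpolyC N K) (map_poly (meval z) q)).['X_i].
    apply: (ideal_equiv hP' _ (PP' _ Pq)).
    rewrite -opprB; apply: (idealN hP').
    rewrite !(horner_coef_wide _ (n := size q)) ?size_poly //; last first.
      by rewrite (leq_trans (size_poly _ _)) ?size_poly.
    rewrite -sumrB; apply: ideal_sum => // j _; rewrite !coef_map /= -mulrBl.
    exact: ideal_mulr.
  rewrite qE rmorph_prod horner_prod => /(prime_ideal_prod pP')[c].
  by rewrite rmorphB /= map_polyX map_polyC /= hornerXsubC; exists c.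
move=> /choice[v Pv].
have modv G : P' (G - (G.@[v])%:MP).
  elim/mpoly_gen_ind: G => [c|i|p1 q IHp IHq|p1 q IHp IHq].
  - by rewrite mevalC subrr; apply: ideal0.
  - by rewrite mevalXU.
  - by rewrite mevalD mpolyCD opprD addrACA; apply: idealD.
  - rewrite mevalM mpolyCM.
    have -> : p1 * q - (p1.@[v])%:MP * (q.@[v])%:MP =
      q * (p1 - (p1.@[v])%:MP) + (p1.@[v])%:MP * (q - (q.@[v])%:MP) by ring.
    by apply: idealD => //; apply: ideal_mull.
have const c : P' c%:MP -> c = 0.
  by rewrite -phiC => /P'z; rewrite /= mevalC.
have PGv G : P' G -> G.@[v] = 0.
  move=> PG; apply: const; rewrite -(subKr G (G.@[v])%:MP).
  by apply: (idealB hP').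
exists v; split; last by move=> G /PP'/PGv.
apply: contraNneq gz => fv; apply/eqP/P'z.
apply: (ideal_equiv hP' (PP' _ Pga)); apply: ideal_mull => //.
by have := modv f; rewrite fv mpolyC0 subr0.
Qed.

End Points.

(** * Chains lifted from a coordinate flag *)

Section Flag.
Variables (K : closedFieldType) (m : nat).

Definition truncate (i : nat) (w : 'I_m -> K) : 'I_m -> K :=
  fun j => if (j < i)%N then 0 else w j.

Definition truncate_vars (i : nat) : m.-tuple {mpoly K[m]} :=
  [tuple if (j < i)%N then 0 else 'X_j | j < m].

(** The ideal generated by the first [i] variables; as the kernel of a substitution it is visibly
    prime. *)
Definition flag (i : nat) : set {mpoly K[m]} :=
  fun g => g \mPo truncate_vars i = 0.

Lemma flag_prime i : prime_ideal (flag i).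
Proof. exact: (ker_prime (comp_mpoly (truncate_vars i))). Qed.

Lemma meval_truncate_vars i g w :
  (g \mPo truncate_vars i).@[w] = g.@[truncate i w].
Proof.
rewrite comp_mpoly_meval; apply: meval_eq => j; rewrite tnth_mktuple /truncate.
by case: ifP => _; rewrite ?meval0 ?mevalXU.
Qed.

Lemma flagP i g : flag i g <-> forall w, g.@[truncate i w] = 0.
Proof.
split=> [fg w|H]; first by rewrite -meval_truncate_vars fg meval0.
apply/eqP; apply: contraT => /mpoly_nonvanishing[w].
by rewrite meval_truncate_vars H eqxx.
Qed.

Lemma flag_point i g : ~ flag i g ->
  exists z, g.@[z] != 0 /\ forall q, flag i q -> q.@[z] = 0.
Proof.
move/eqP/mpoly_nonvanishing => [w]; rewrite meval_truncate_vars => gw.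
by exists (truncate i w); split=> // q /flagP ->.
Qed.

Lemma flag_sub i g : flag i g -> flag i.+1 g.
Proof.
move=> /flagP fg; apply/flagP => w; rewrite -[RHS](fg (truncate i.+1 w)).
apply: meval_eq => j; rewrite /truncate; case: (ltnP j i) => // ji.
by rewrite ltnS ltnW.
Qed.

Lemma flag_var (i : 'I_m) k : flag k 'X_i <-> (i < k)%N.
Proof.
split=> [/flagP /(_ (fun=> 1))|lt]; last first.
  by apply/flagP => w; rewrite mevalXU /truncate lt.
by rewrite mevalXU /truncate; case: ltnP => // _ /eqP; rewrite oner_eq0.
Qed.

End Flag.

Section Chain.
Variables (K : closedFieldType) (N m : nat) (z : m.+1.-tuple {mpoly K[N]}).
Hypothesis z_homog : forall i, tnth z i \is 1.-homog.
Variables (I : set {mpoly K[N]}) (hI : is_ideal I).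
Hypothesis z_free : forall g, I (g \mPo z) -> g = 0.
Hypothesis z_integral : forall h, integral_over_mod (comp_mpoly z) I h.

Let over_flag i (P : set {mpoly K[N]}) := [/\ prime_ideal P,
  forall x, I x -> P x & forall a, P (a \mPo z) <-> flag i a].

Lemma primes_over_flag : exists P : nat -> set {mpoly K[N]},
  forall i, over_flag i (P i) /\ forall x, P i x -> P i.+1 x.
Proof.
have H0 : exists P, over_flag 0 P.
  have [||P [pP IP Pz]] := @going_up _ _ (comp_mpoly z) I (@flag K m.+1 0) hI z_integral.
  - exact: flag_prime.
  - by move=> a /z_free ->; apply: (ideal0 (prime_is_ideal (flag_prime K m.+1 0))).
  - by exists P; split.
have step i P : over_flag i P ->
    exists P', over_flag i.+1 P' /\ forall x, P x -> P' x.
  move=> [pP IP Pz].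
  have [|h||a Pa|P' [pP' PP' P'z]] :=
    @going_up _ _ (comp_mpoly z) P (@flag K m.+1 i.+1).
  - exact: prime_is_ideal.
  - exact: integral_over_mod_mono (z_integral h).
  - exact: flag_prime.
  - by apply: flag_sub; apply/Pz.
  - by exists P'; split=> //; split=> // x Ix; apply: PP'; apply: IP.
(* Each prime must contain the one chosen before it, so the choice is made by recursion on subset
   types. *)
pose next i (s : {P | over_flag i P}) : {P' | over_flag i.+1 P'} :=
  exist _ _ (projT2 (cid (step i _ (projT2 s)))).1.
pose fam := nat_rect (fun i => {P | over_flag i P}) (cid H0) next.
exists (fun i => sval (fam i)) => i; split; first exact: (svalP (fam i)).
exact: (projT2 (cid (step i _ (projT2 (fam i))))).2.
Qed.

(** The primes produced by going up need not be homogeneous, so only their homogeneous elements are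
    used as equations. *)
Definition vanishing_cone (P : set {mpoly K[N]}) : set 'rV[K]_N :=
  fun v => v != 0 /\ forall G, (exists k, G \is k.-homog) -> P G -> peval G v = 0.

Lemma over_flag_point i P f : over_flag i P -> ~ P f ->
  exists v : 'rV_N, peval f v != 0 /\ forall G, P G -> peval G v = 0.
Proof.
move=> [pP IP Pz] nf.
have [|h|g ng|v [fv Pv]] := @nullstellensatz K N m.+1 (comp_mpoly z) _ P pP f _ _ nf.
- by move=> c; rewrite /= comp_mpolyC.
- exact: integral_over_mod_mono (z_integral h).
- have [|w [gw Qw]] := @flag_point K m.+1 i g; first by move/Pz.
  by exists w; split=> // q /Pz /Qw.
exists (\row_j v j).
have E G : peval G (\row_j v j) = G.@[v] by apply: meval_eq => j; rewrite mxE.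
by rewrite E; split=> // G PG; rewrite E; apply: Pv.
Qed.

Lemma peval_homog0 k (G : {mpoly K[N]}) : G \is k.-homog -> (0 < k)%N -> peval G 0 = 0.
Proof.
move=> hG k0; rewrite /peval -[RHS](dhomog_at0 hG k0).
by apply: meval_eq => i; rewrite mxE.
Qed.

(** Applying [over_flag_point] to [f] times the i-th form of [z], which is outside [P], excludes the
    origin: a linear form does not vanish at the point found. *)
Lemma var_point i P f k : (i <= m)%N -> over_flag i P -> f \is k.-homog -> ~ P f ->
  exists v : 'rV_N, vanishing_cone P v /\ peval f v != 0.
Proof.
move=> le_im oP hf nf; have [pP IP Pz] := oP.
pose j : 'I_m.+1 := Ordinal (le_im : (i < m.+1)%N).
have nzj : ~ P ('X_j \mPo z) by move/Pz/flag_var; rewrite /= ltnn.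
have zjE : 'X_j \mPo z = tnth z j by rewrite comp_mpolyXU -tnth_nth.
have [|v [fv Pv]] := @over_flag_point i P (f * tnth z j) oP.
  by move/(prime_mul pP) => []; rewrite -?zjE.
move: fv; rewrite /peval mevalM mulf_eq0 negb_or -/(peval _ _) => /andP[fv zv].
exists v; split=> //; split; last by move=> G _ /Pv.
by apply: contra_neq zv => ->; apply: peval_homog0 (z_homog j) _.
Qed.

(** If neither closed set contains the cone, each has a homogeneous equation outside [P]; their
    product is outside [P] and is nonzero at some point of the cone. *)
Lemma vanishing_cone_irreducible i P : (i <= m)%N -> over_flag i P ->
  proj_irreducible (vanishing_cone P).
Proof.
move=> le_im oP; have [pP IP Pz] := oP; split.
- exists (fun G => (exists k, G \is k.-homog) /\ P G); split; first by move=> G [].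
  apply/seteqP; split=> v [v0 Pv]; split=> // G; first by case; apply: Pv.
  by move=> hG PG; apply: Pv.
- have [|v [Pv _]] := var_point le_im oP (dhomog1 _ _); last by exists v.
  exact: prime_proper.
move=> A B [SA [hA ->]] [SB [hB ->]] cov; apply: contrapT => /not_orP[nA nB].
have wit (S : set {mpoly K[N]}) : (forall G, S G -> exists k, G \is k.-homog) ->
    ~ (vanishing_cone P `<=` [set v | v != 0 /\ forall G, S G -> peval G v = 0])%classic ->
    exists f k, [/\ S f, f \is k.-homog & ~ P f].
  move=> hS nS; apply: contrapT => H; apply: nS => v [v0 Pv]; split=> // G SG.
  have [k hG] := hS G SG; apply: Pv; first by exists k.
  by apply: contrapT => nPG; apply: H; exists G, k.
have [f [k [SAf hf nf]]] := wit SA hA nA.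
have [g [l [SBg hg ng]]] := wit SB hB nB.
have [|v [Pv]] := var_point le_im oP (dhomogM hf hg).
  by move/(prime_mul pP) => [].
rewrite /peval mevalM mulf_eq0 negb_or => /andP[fv gv].
by have [[_ /(_ f SAf)/eqP]|[_ /(_ g SBg)/eqP]] := cov v Pv; apply/negP.
Qed.

(** The cones of the lifted primes, in reverse order, form the chain; the inclusions are strict
    because the k-th form of [z] lies in the prime of index k + 1 but not in that of index k. The m
    + 1 linear forms give projective dimension m. *)
Theorem integral_free_chain (Z : set 'rV[K]_N) :
  (vanishing_cone I `<=` Z)%classic -> irreducible_chain Z m.
Proof.
move=> IZ; have [P HP] := primes_over_flag.
exists (fun i => vanishing_cone (P (m - i)%N)); split.
- by move=> i _; apply: vanishing_cone_irreducible (HP _).1; rewrite leq_subr.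
- move=> i lt_im.
  have E : (m - i = (m - i.+1).+1)%N by lia.
  rewrite E; set k := (m - i.+1)%N.
  have le_km : (k <= m)%N by rewrite leq_subr.
  have [oP PP'] := HP k; have [[_ _ P'z] _] := HP k.+1.
  split=> [v [v0 Pv]|sub]; first by split=> // G hG /PP'; apply: Pv.
  pose j : 'I_m.+1 := Ordinal (le_km : (k < m.+1)%N).
  have zjE : 'X_j \mPo z = tnth z j by rewrite comp_mpolyXU -tnth_nth.
  have [|v [Pv /eqP zv]] := var_point le_km oP (z_homog j).
    by have [_ _ Pz] := oP; rewrite -zjE => /Pz/flag_var; rewrite /= ltnn.
  apply: zv; have [_ Pv'] := sub _ Pv; apply: Pv'; first by exists 1%N.
  by rewrite -zjE; apply/P'z/flag_var.
- have [[_ IP _] _] := HP (m - m)%N.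
  by move=> v [v0 Pv]; apply: IZ; split=> // G hG /IP; apply: Pv.
Qed.

End Chain.

(** * Normality *)

Section LinearSubstitution.
Variables (K : fieldType) (N : nat).
Implicit Types (S T : 'M[K]_N) (g : {mpoly K[N]}).

Definition linear_forms T : N.-tuple {mpoly K[N]} :=
  [tuple \sum_j T i j *: 'X_j | i < N].

Lemma linear_forms_homog T i : tnth (linear_forms T) i \is 1.-homog.
Proof.
rewrite tnth_mktuple; apply: rpred_sum => j _; apply: rpredZ.
by rewrite dhomogX /= mdeg1.
Qed.

Lemma comp_linear_var T i : 'X_i \mPo linear_forms T = \sum_j T i j *: 'X_j.
Proof. by rewrite comp_mpolyXU -tnth_nth tnth_mktuple. Qed.

Lemma meval_linear T g (w : 'I_N -> K) :
  (g \mPo linear_forms T).@[w] = g.@[fun i => \sum_j T i j * w j].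
Proof.
rewrite comp_mpoly_meval; apply: meval_eq => i; rewrite tnth_mktuple rmorph_sum.
by apply: eq_bigr => j _; rewrite /= mevalZ mevalXU.
Qed.

Lemma comp_linearM S T g :
  (g \mPo linear_forms S) \mPo linear_forms T = g \mPo linear_forms (S *m T).
Proof.
elim/mpoly_gen_ind: g => [c|i|p q IHp IHq|p q IHp IHq].
- by rewrite !comp_mpolyC.
- rewrite !comp_linear_var rmorph_sum /=.
  under eq_bigr => j _ do rewrite comp_mpolyZ comp_linear_var scaler_sumr.
  rewrite exchange_big /=; apply: eq_bigr => k _; rewrite mxE scaler_suml.
  by apply: eq_bigr => j _; rewrite scalerA.
- by rewrite !comp_mpolyD IHp IHq.
- by rewrite !rmorphM /= IHp IHq.
Qed.

Lemma comp_linear1 g : g \mPo linear_forms 1%:M = g.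
Proof.
rewrite -[RHS]comp_mpoly_id; congr (_ \mPo _); apply: eq_from_tnth => i.
rewrite !tnth_mktuple (bigD1 i) //= mxE eqxx scale1r big1 ?addr0 // => j ji.
by rewrite mxE eq_sym (negbTE ji) scale0r.
Qed.

Lemma comp_linearK T : T \in unitmx ->
  cancel (comp_mpoly (linear_forms T)) (comp_mpoly (linear_forms (invmx T))).
Proof. by move=> uT g; rewrite comp_linearM mulmxV // comp_linear1. Qed.

Lemma comp_linearKV T : T \in unitmx ->
  cancel (comp_mpoly (linear_forms (invmx T))) (comp_mpoly (linear_forms T)).
Proof. by move=> uT g; rewrite comp_linearM mulVmx // comp_linear1. Qed.

Lemma mderiv_linear T g i :
  (g \mPo linear_forms T)^`M(i) = \sum_j T j i *: (g^`M(j) \mPo linear_forms T).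
Proof.
elim/mpoly_gen_ind: g => [c|k|p q IHp IHq|p q IHp IHq].
- rewrite comp_mpolyC mderivC big1 // => j _.
  by rewrite mderivC comp_mpoly0 scaler0.
- rewrite comp_linear_var raddf_sum /=.
  rewrite (bigD1 i) //= big1 => [|j ji]; last first.
    by rewrite mderivZ mderiv_var (negbTE ji) mpolyC0 scaler0.
  rewrite [RHS](bigD1 k) //= big1 => [|j jk]; last first.
    by rewrite mderiv_var eq_sym (negbTE jk) mpolyC0 comp_mpoly0 scaler0.
  by rewrite mderivZ !mderiv_var !eqxx !mpolyC1 comp_mpoly1.
- rewrite comp_mpolyD mderivD IHp IHq -big_split; apply: eq_bigr => j _ /=.
  by rewrite mderivD comp_mpolyD scalerDr.
- rewrite rmorphM /= mderivM IHp IHq mulr_suml mulr_sumr -big_split.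
  apply: eq_bigr => j _ /=; rewrite mderivM comp_mpolyD !rmorphM /= scalerDr.
  by rewrite -scalerAl -scalerAr.
Qed.

End LinearSubstitution.

(** [1%:M + M] is the identity with column [i0] replaced by [u], and [M *m M] is a multiple of [M],
    which yields its inverse; a transposition then moves that column to the end. Substituting such a
    [T] moves the last coordinate point to [u]. *)
Lemma unitmx_with_last_col (K : fieldType) (n : nat) (u : 'I_n.+1 -> K) i0 :
  u i0 != 0 -> exists2 T : 'M[K]_n.+1, T \in unitmx & forall i, T i ord_max = u i.
Proof.
move=> u0; pose w : 'cV[K]_n.+1 := \col_i (u i - (i == i0)%:R).
pose r : 'rV[K]_n.+1 := delta_mx 0 i0.
have rw : r *m w = (u i0 - 1)%:M.
  by rewrite -rowE; apply/matrixP => i j; rewrite !ord1 !mxE !eqxx.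
pose M := w *m r; have MM : M *m M = (u i0 - 1) *: M.
  by rewrite /M mulmxA -(mulmxA w r) rw mul_mx_scalar -scalemxAl.
have E1 : (1%:M + M) *m (1%:M - (u i0)^-1 *: M) = 1%:M.
  rewrite mulmxBr mulmx1 -scalemxAr mulmxDl mul1mx MM -{2}[M]scale1r -scalerDl.
  by rewrite scalerA addrCA subrr addr0 mulVf // scale1r addrK.
have [uE _] := mulmx1_unit E1.
exists ((1%:M + M) *m tperm_mx i0 ord_max).
  by rewrite unitmx_mul uE unitmx_perm.
move=> i; rewrite -xcolE mxE tpermR !mxE big_ord1 !mxE !eqxx mulr1.
by rewrite addrC subrK.
Qed.

(** The ideal generated by [F] and [H]. For [F] prime not dividing [H], [comb F H G] expresses that
    [G / H] lies in the ring modulo [F]. *)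
Definition comb (R : comNzRingType) (F H x : R) : Prop :=
  exists P Q, x = P * H + Q * F.

Section Combinations.
Variables (R : comNzRingType) (F H : R).

Lemma comb_ideal : is_ideal (comb F H).
Proof.
split=> [|_ _ [P [Q ->]] [P' [Q' ->]]|a _ [P [Q ->]]].
- by exists 0, 0; rewrite !mul0r addr0.
- by exists (P + P'), (Q + Q'); ring.
- by exists (a * P), (a * Q); ring.
Qed.

Lemma comb_dvds x : dvds F x -> comb F H x.
Proof. by move=> [Q ->]; exists 0, Q; rewrite mul0r add0r. Qed.

Definition conductor (G : R) : set R := fun x => comb F H (x * G).

Lemma conductor_ideal G : is_ideal (conductor G).
Proof.
have hC := comb_ideal; split=> [|x y cx cy|a x cx]; rewrite /conductor.
- by rewrite mul0r; apply: ideal0.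
- by rewrite mulrDl; apply: idealD.
- by rewrite -mulrA; apply: ideal_mull.
Qed.

Lemma conductor_dvds G x : dvds F x -> conductor G x.
Proof. by move=> Fx; apply: comb_dvds; rewrite mulrC; apply: dvds_mull. Qed.

(** Modulo [F] the fraction [G / H] equals [v G / h], whose denominator can be chosen in the base
    ring by [monic_prime_elimination]. *)
Lemma integral_mod_scale G h u v : h = u * F + v * H ->
  integral_mod F G H -> integral_mod F (v * G) h.
Proof.
move=> hE [r [a [Q rel]]]; exists r, a.
suff : dvds F ((v * G) ^+ r + \sum_(i < r) a i * (v * G) ^+ i * h ^+ (r - i)).
  by [].
have -> : (v * G) ^+ r + \sum_(i < r) a i * (v * G) ^+ i * h ^+ (r - i) =
    v ^+ r * (G ^+ r + \sum_(i < r) a i * G ^+ i * H ^+ (r - i)) +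
    \sum_(i < r) a i * (v * G) ^+ i * (h ^+ (r - i) - (v * H) ^+ (r - i)).
  rewrite mulrDr exprMn -addrA; congr (_ + _); rewrite mulr_sumr -big_split.
  apply: eq_bigr => i _ /=.
  have -> : v ^+ r = v ^+ (r - i) * v ^+ i by rewrite -exprD subnK // ltnW.
  by rewrite !exprMn; ring.
apply: dvdsD; first by apply: dvds_mull; exists Q.
apply: big_ind => [||i _]; first by exists 0; rewrite mul0r.
  exact: dvdsD.
apply: dvds_mull; rewrite subrXX hE addrK.
by rewrite mulrAC; apply: dvds_mull; exists 1; rewrite mul1r.
Qed.

(** Undoes the change of denominator: modulo [F], [v y] is [P v H], and the prime [F] does not
    divide [v] since it does not divide [h]. *)
Lemma comb_descend h u v y : prime_elt F -> ~ dvds F h -> h = u * F + v * H ->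
  comb F h (v * y) -> comb F H y.
Proof.
move=> [_ pF] nh hE [P [Q E]].
have [||[S yE]] := pF v (y - P * H).
- exists (P * u + Q); rewrite mulrBr E hE; ring.
- move=> Fv; case: nh; rewrite hE; apply: dvdsD; first by exists u.
  by rewrite mulrC; apply: dvds_mull.
- by exists P, S; rewrite -yE addrC subrK.
Qed.

End Combinations.

Section RingIso.
Variables (R S : comNzRingType) (Th : {rmorphism S -> R}) (Ps : {rmorphism R -> S}).
Hypotheses (ThK : cancel Th Ps) (PsK : cancel Ps Th).
Variables (F e e' : R) (f : S).
Hypotheses (fE : Th f = e * F) (FE : F = e' * Th f).

(** The equations [f] and [F] correspond only up to the factors [e] and [e'], because charts rescale
    them to become monic. *)
Lemma iso_dvds x : dvds f (Ps x) <-> dvds F x.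
Proof.
split=> [[Q E]|[Q ->]].
  by exists (Th Q * e); rewrite -[LHS]PsK E rmorphM fE mulrA.
by exists (Ps Q * Ps e'); rewrite FE !rmorphM /= ThK mulrA.
Qed.

Lemma iso_comb H x : comb f (Ps H) (Ps x) <-> comb F H x.
Proof.
split=> [[P [Q E]]|[P [Q ->]]].
  exists (Th P), (Th Q * e); rewrite -[LHS]PsK E rmorphD !rmorphM /= fE PsK.
  by rewrite mulrA.
exists (Ps P), (Ps Q * Ps e'); rewrite {1}FE rmorphD !rmorphM /= ThK.
by rewrite mulrA.
Qed.

Lemma iso_prime : prime_elt F -> prime_elt f.
Proof.
move=> [nF pF]; split; first by rewrite -(rmorph1 Ps) => /iso_dvds.
move=> a b; rewrite -(ThK a) -(ThK b) -rmorphM => /iso_dvds /pF[] Fx; [left|right];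
  exact/iso_dvds.
Qed.

Lemma iso_integral_mod G H : integral_mod F G H -> integral_mod f (Ps G) (Ps H).
Proof.
move=> [r [a [Q E]]]; exists r, (fun i => Ps (a i)), (Ps Q * Ps e').
have := congr1 Ps E; rewrite rmorphD rmorphXn rmorph_sum /= => E'.
have -> : Ps Q * Ps e' * f = Ps (Q * F) by rewrite FE !rmorphM /= ThK mulrA.
rewrite -E'; congr (_ + _); apply: eq_bigr => i _.
by rewrite !rmorphM !rmorphXn.
Qed.

End RingIso.

Lemma monic_const_not_dvds (A : idomainType) (f : {poly A}) (h : A) :
  f \is monic -> prime_elt f -> h != 0 -> ~ dvds f h%:P.
Proof.
move=> mf [nf1 _] h0 [Q E].
have Q0 : Q != 0.
  by apply: contra_neq h0 => Q0; apply/eqP; rewrite -polyC_eq0 E Q0 mul0r.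
have := congr1 (fun p : {poly A} => size p) E.
rewrite size_polyC h0 size_Mmonic // => sE.
have sf : size f = 1%N.
  by move: Q0 sE (monic_neq0 mf); rewrite -!size_poly_gt0 /=; move: (size Q) (size f) => x y; lia.
apply: nf1; exists 1; rewrite mul1r.
by move: mf; rewrite monicE lead_coefE sf /= => /eqP fE; rewrite (size1_polyC (eq_leq sf)) fE.
Qed.

Lemma deriv_in_conductor (n : nat) (K : fieldType) (f G H : {poly {mpoly K[n]}}) :
  f \is monic -> prime_elt f -> ~ dvds f H -> integral_mod f G H ->
  conductor f H G f^`().
Proof.
move=> mf pf nH int; have [h [u [v [h0 hE]]]] := monic_prime_elimination mf pf nH.
have nh := monic_const_not_dvds mf pf h0.
apply: (comb_descend pf nh hE); rewrite mulrCA.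
have [P [Q E]] := deriv_conductor mf h0 (integral_mod_scale hE int).
by exists P, Q.
Qed.

Lemma regular_pair_in_conductor (A : idomainType) (f G H : {poly A}) (al be : A) :
  f \is monic -> prime_elt f -> ~ dvds f H -> be != 0 ->
  (forall a b, al * b = be * a -> exists q, b = be * q) ->
  conductor f H G al%:P -> conductor f H G be%:P -> comb f H G.
Proof.
move=> mf pf nH be0 reg cal cbe.
have [h [u [v [h0 hE]]]] := monic_prime_elimination mf pf nH.
have nh := monic_const_not_dvds mf pf h0.
apply: (comb_descend pf nh hE).
have lift c : conductor f H G c%:P -> comb f h%:P (c%:P * (v * G)).
  move=> [P [Q E]]; exists P, (v * Q - P * u); rewrite mulrCA E hE; ring.
exact: (regular_pair_clears mf h0 be0 reg (lift _ cal) (lift _ cbe)).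
Qed.

Lemma closed_mpoly_point (K : closedFieldType) (n : nat) (p : {mpoly K[n.+1]}) :
  p != 0 -> exists v i, p.@[v] != 0 /\ v i != 0.
Proof.
move=> p0; have [|v] := @mpoly_nonvanishing K n.+1 (p * 'X_ord0).
  by rewrite mulf_neq0 // -msize_poly_eq0 msizeX.
rewrite mevalM mevalXU mulf_eq0 negb_or => /andP[pv v0]; by exists v, ord0.
Qed.

Lemma coef_muni_linear (K : fieldType) (n d : nat) (F : {mpoly K[n.+1]}) T :
  F \is d.-homog ->
  (muni (F \mPo linear_forms T))`_d = (F.@[fun i => T i ord_max])%:MP.
Proof.
move=> hF; rewrite meval_last_point; last first.
  by apply: dhomog_comp hF => i; apply: linear_forms_homog.
rewrite meval_linear; congr (_%:MP); apply: meval_eq => i.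
rewrite (bigD1 ord_max) //= /last_point eqxx mulr1 big1 ?addr0 // => j /negbTE ->.
by rewrite mulr0.
Qed.

(** Here [g] may be inhomogeneous. The last coordinate point is moved to a point [u] where the top
    form of [g] is nonzero; that value becomes the leading coefficient. *)
Lemma monic_coordinates (K : closedFieldType) (n : nat) (g : {mpoly K[n.+1]}) :
  g != 0 -> exists (T : 'M[K]_n.+1) (c : K), [/\ T \in unitmx, c != 0 &
    muni (c *: (g \mPo linear_forms T)) \is monic].
Proof.
move=> g0; pose k := mdeg (mlead g).
have sg : msize g = k.+1 by rewrite mlead_deg.
have gk0 : pihomog mdeg k g != 0.
  have : (pihomog mdeg k g)@_(mlead g) != 0.
    rewrite pihomogE raddf_sum /= -big_filter.
    rewrite (bigD1_seq (mlead g)) /= ?filter_uniq ?msupp_uniq //; last first.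
      by rewrite mem_filter eqxx mlead_supp.
    rewrite mcoeffZ mcoeffX eqxx mulr1 big1 ?addr0 ?mleadc_eq0 // => m mg.
    by rewrite mcoeffZ mcoeffX (negbTE mg) mulr0.
  by apply: contra_neq => ->; rewrite mcoeff0.
have [u [i0 [gu u0]]] := closed_mpoly_point gk0.
have [T uT Tu] := unitmx_with_last_col u0.
exists T, ((pihomog mdeg k g).@[u])^-1; split=> //; first by rewrite invr_eq0.
rewrite muniZ; set c := _.@[u] in gu *.
have gE : muni (g \mPo linear_forms T) =
    (\sum_(i < k) muni (pihomog mdeg i g \mPo linear_forms T)) +
    muni (pihomog mdeg k g \mPo linear_forms T).
  rewrite [in LHS](pihomog_partitionE (eq_leq sg)) big_ord_recr /=.
  rewrite comp_mpolyD muniD; congr (_ + _).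
  by rewrite (raddf_sum (comp_mpoly (linear_forms T))) (raddf_sum (@muni n K)).
have hom i : pihomog mdeg i g \mPo linear_forms T \is i.-homog.
  by apply: dhomog_comp (pihomogP _ _ _) => j; apply: linear_forms_homog.
have sl : (size (\sum_(i < k) muni (pihomog mdeg i g \mPo linear_forms T))%R <= k)%N.
  apply: (big_ind (fun p : {poly _} => size p <= k)%N); first by rewrite size_poly0.
    by move=> p q sp sq; rewrite (leq_trans (size_polyD _ _)) // geq_max sp sq.
  by move=> i _; rewrite (leq_trans (size_muni_homog (hom i))).
have ck : (muni (g \mPo linear_forms T))`_k = c%:MP.
  rewrite gE coefD nth_default // add0r coef_muni_linear ?pihomogP //.
  by congr (_%:MP); apply: meval_eq => i; rewrite Tu.
have sk : size (muni (g \mPo linear_forms T)) = k.+1.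
  apply/eqP; rewrite eqn_leq; apply/andP; split.
    rewrite gE (leq_trans (size_polyD _ _)) // geq_max (leq_trans sl) //=.
    exact: size_muni_homog (hom k).
  apply: contraTT isT; rewrite -leqNgt => /leq_sizeP/(_ k (leqnn k)).
  by rewrite ck => /eqP; rewrite mpolyC_eq0 (negbTE gu).
rewrite monicE lead_coefZ lead_coefE sk /= ck -mpolyCM mulVf //.
Qed.

Lemma linear_chart (K : fieldType) (n : nat) (T : 'M[K]_n.+1) : T \in unitmx ->
  exists (Ps : {rmorphism {mpoly K[n.+1]} -> {poly {mpoly K[n]}}})
         (Th : {rmorphism {poly {mpoly K[n]}} -> {mpoly K[n.+1]}}),
  [/\ cancel Th Ps, cancel Ps Th, forall g, Ps g = muni (g \mPo linear_forms T)
    & forall p, Th p = of_muni p \mPo linear_forms (invmx T)].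
Proof.
move=> uT; exists (@muni n K \o comp_mpoly (linear_forms T)).
exists (comp_mpoly (linear_forms (invmx T)) \o @of_muni n K); split=> // p.
  by rewrite /= comp_linearKV // of_muniK.
by rewrite /= muniK comp_linearK.
Qed.

Section Normality.
Variables (K : closedFieldType) (n d : nat) (F G H : {mpoly K[n.+3]}).
Hypotheses (d_gt0 : (0 < d)%N) (F_homog : F \is d.-homog) (F0 : F != 0).
Hypotheses (F_prime : prime_elt F) (nFH : ~ dvds F H).
Hypothesis int_GH : integral_mod F G H.

(** In coordinates whose last point is [u], the leading coefficient of [F] is [F.@[u]] and the
    derivative in the last variable is the directional one, so [deriv_in_conductor] applies. *)
Lemma directional_in_conductor (u : 'I_n.+3 -> K) : F.@[u] != 0 ->
  conductor F H G (\sum_j u j *: F^`M(j)).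
Proof.
move=> Fu; have [i0 u0] : exists i, u i != 0.
  apply: contrapT => Hu; move: Fu; rewrite (meval_eq (v2 := fun=> 0)).
    by rewrite (dhomog_at0 F_homog) ?eqxx.
  by move=> i; apply/eqP/negPn/negP => ui; apply: Hu; exists i.
have [T uT Tu] := unitmx_with_last_col u0.
have [Ps [Th [ThK PsK PsE _]]] := linear_chart uT.
have [c cE] : exists c, c = F.@[u] by exists F.@[u].
have c0 : c != 0 by rewrite cE.
have [f fPs] : exists f, f = Ps ((c^-1)%:MP * F) by eexists.
have fE : Th f = (c^-1)%:MP * F by rewrite fPs PsK.
have FE : F = c%:MP * Th f by rewrite fE mulrA -mpolyCM mulfV // mpolyC1 mul1r.
have fm : f = muni (c^-1 *: (F \mPo linear_forms T)).
  by rewrite fPs PsE mul_mpolyC comp_mpolyZ.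
have sF := size_muni_homog (dhomog_comp (@linear_forms_homog _ _ T) F_homog).
have cF : (muni (F \mPo linear_forms T))`_d = c%:MP.
  by rewrite coef_muni_linear // cE; congr (_%:MP); apply: meval_eq.
have {}sF : size (muni (F \mPo linear_forms T)) = d.+1.
  apply/eqP; rewrite eqn_leq sF /= ltnNge; apply/negP => /leq_sizeP/(_ d (leqnn d)).
  by rewrite cF => /eqP; rewrite mpolyC_eq0 (negbTE c0).
have mf : f \is monic.
  by rewrite monicE fm muniZ lead_coefZ lead_coefE sF /= cF -mpolyCM mulVf.
have pf := iso_prime ThK PsK fE FE F_prime.
have nfH : ~ dvds f (Ps H) by move/(iso_dvds ThK PsK fE FE).
have intf := iso_integral_mod ThK FE int_GH.
have := deriv_in_conductor mf pf nfH intf.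
have -> : f^`() = Ps ((c^-1)%:MP * \sum_j u j *: F^`M(j)).
  rewrite fm -muni_deriv mderivZ mderiv_linear PsE mul_mpolyC comp_mpolyZ.
  rewrite (raddf_sum (comp_mpoly _)) /=; congr (muni (_ *: _)); apply: eq_bigr => j _.
  by rewrite comp_mpolyZ Tu.
rewrite /conductor -rmorphM => /(iso_comb ThK PsK fE FE).
move/(ideal_mull (comb_ideal F H) c%:MP).
by rewrite !mulrA -mpolyCM mulfV // mpolyC1 mul1r.
Qed.

(** The directions [u0] and [u0 + s e_j] are both allowed for a suitable nonzero [s], and the
    difference of the two directional derivatives is [s] times the j-th partial derivative. *)
Lemma derivative_in_conductor j : conductor F H G F^`M(j).
Proof.
have hC := conductor_ideal F H G.
have [u0 Fu0] := mpoly_nonvanishing F0.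
pose e i : K := (i == j)%:R.
pose q : {poly K} := mmap (@polyC K) (fun i => (u0 i)%:P + e i *: 'X) F.
have qE s : q.[s] = F.@[fun i => u0 i + e i * s].
  rewrite /q; elim/mpoly_gen_ind: F => [c|i|p1 p2 IH1 IH2|p1 p2 IH1 IH2].
  - by rewrite mmapC hornerC mevalC.
  - by rewrite mmapX mmap1U mevalXU hornerD hornerC hornerZ hornerX.
  - by rewrite mmapD hornerD mevalD IH1 IH2.
  - by rewrite rmorphM hornerM mevalM /= IH1 IH2.
have q0 : q * 'X != 0.
  rewrite mulf_neq0 ?polyX_eq0 //; apply: contra_neq Fu0 => q0.
  have := qE 0; rewrite q0 horner0 => ->; apply: meval_eq => i.
  by rewrite mulr0 addr0.
have [s] := closed_nonrootP _ q0; rewrite rootE hornerM hornerX mulf_eq0 negb_or.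
rewrite qE => /andP[Fs s0].
have := idealB hC (directional_in_conductor Fs) (directional_in_conductor Fu0).
rewrite -sumrB (bigD1 j) //= big1 => [|i ij]; last first.
  by rewrite /e (negbTE ij) mul0r addr0 subrr.
rewrite addr0 -scalerBl /e eqxx mul1r addrC addKr -mul_mpolyC.
move/(ideal_mull hC (s^-1)%:MP).
by rewrite mulrA -mpolyCM mulVf // mpolyC1 mul1r.
Qed.

End Normality.

Lemma dhomog_mderiv (R : idomainType) (n d : nat) (p : {mpoly R[n]}) i :
  p \is d.-homog -> p^`M(i) \is d.-1.-homog.
Proof.
move=> /dhomogP hp; apply/dhomogP => m; rewrite mcoeff_msupp mcoeff_deriv => nz.
have : (m + U_(i))%MM \in msupp p.
  by rewrite mcoeff_msupp; apply: contra_neq nz => ->; rewrite mul0rn.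
by move/hp => /= <-; rewrite mdegD mdeg1 addn1.
Qed.

Lemma integral_over_mod_poly (A B R : comNzRingType) (phi : {rmorphism B -> R})
    (Th : {rmorphism {poly A} -> R}) (I : set R) (f : {poly A}) :
  is_ideal I -> f \is monic -> I (Th f) ->
  (forall a, integral_over_mod phi I (Th a%:P)) ->
  forall p, integral_over_mod phi I (Th p).
Proof.
move=> hI mf If intA.
have intX : integral_over_mod phi I (Th 'X).
  apply: (@integral_over_mod_root _ _ phi I hI (map_poly (Th \o polyC) f)).
  - exact: monic_map.
  - by rewrite map_poly_comp horner_map -[(map_poly _ f).['X]]/(f \Po 'X) comp_polyXr.
  - by move=> i; rewrite coef_map; apply: intA.
elim/poly_ind => [|p c IH]; first by rewrite -(polyC0 A); apply: intA.
rewrite rmorphD rmorphM.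
apply: (integral_over_modD hI _ (intA c)); exact: (integral_over_modM hI IH intX).
Qed.

Definition singular_cone (K : fieldType) (N : nat) (F : {mpoly K[N]}) : set 'rV[K]_N :=
  fun v => [/\ v != 0, peval F v = 0 & forall i, peval F^`M(i) v = 0].

(* If the conductor [c] of [G / H] met a generic polynomial subring in [n + 1]
   variables (or [n + 2] of them) trivially, its zero locus would contain a chain
   of length [n]; otherwise it contains a regular pair and [G / H] is regular.
   The dimension of the hypersurface is [n + 1] here. *)
Theorem normal_hypersurface (K : closedFieldType) (n d : nat) (F G H : {mpoly K[n.+3]}) :
  (0 < d)%N -> F \is d.-homog -> F != 0 -> prime_elt F ->
  (forall m, (n <= m)%N -> ~ irreducible_chain (singular_cone F) m) ->
  ~ dvds F H -> integral_mod F G H -> comb F H G.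
Proof.
move=> d0 hF F0 pF noC nFH intGH.
pose cd := conductor F H G; have hC : is_ideal cd := conductor_ideal F H G.
have cdF : cd F by apply: conductor_dvds; exists 1; rewrite mul1r.
have cdD j : cd F^`M(j) := derivative_in_conductor d0 hF F0 pF nFH intGH j.
have coneS : (vanishing_cone cd `<=` singular_cone F)%classic.
  move=> v [v0 Pv]; split=> // [|i]; apply: Pv => //; first by exists d.
  by exists d.-1; apply: dhomog_mderiv.
(* Noether normalization: with [F] monic in the last variable, everything is integral modulo the
   conductor over the other n + 2 variables. *)
have [T1 [c1 [uT1 c10 mf]]] := monic_coordinates F0.
have [Ps [Th [ThK PsK PsE ThE]]] := linear_chart uT1.
set f := muni _ in mf.
have fE : Th f = c1%:MP * F.
  by rewrite -[RHS]PsK PsE mul_mpolyC comp_mpolyZ.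
have FE : F = (c1^-1)%:MP * Th f by rewrite fE mulrA -mpolyCM mulVf // mpolyC1 mul1r.
have cdf : cd (Th f) by rewrite fE; apply: ideal_mull.
have [z1 z1E] : exists z1 : n.+2.-tuple _, forall i, tnth z1 i = Th ('X_i)%:P.
  by exists [tuple Th ('X_i)%:P | i < n.+2] => i; rewrite tnth_mktuple.
have ThC c : Th (c%:MP)%:P = c%:MP by rewrite ThE of_muniC mwidenC comp_mpolyC.
have Thz a : a \mPo z1 = Th a%:P.
  elim/mpoly_gen_ind: a => [c|i|p q IHp IHq|p q IHp IHq].
  - by rewrite comp_mpolyC ThC.
  - by rewrite comp_mpolyXU -tnth_nth z1E.
  - by rewrite comp_mpolyD polyCD (rmorphD Th); congr (_ + _); [exact: IHp|exact: IHq].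
  - by rewrite (rmorphM (comp_mpoly z1)) polyCM (rmorphM Th); congr (_ * _); [exact: IHp|exact: IHq].
have z1h g k : g \is k.-homog -> Th g%:P \is k.-homog.
  rewrite ThE of_muniC => hg; apply: dhomog_comp (mwiden_homog hg) => i.
  exact: linear_forms_homog.
have int1 p : integral_over_mod (comp_mpoly z1) cd (Th p).
  apply: (integral_over_mod_poly hC mf cdf) => a.
  by rewrite -Thz; apply: (integral_over_mod_base (comp_mpoly z1) hC).
have [free1|nfree1] := pselect (forall a, cd (a \mPo z1) -> a = 0).
  case: (noC n.+1) => //; apply: (@integral_free_chain K _ _ z1 _ cd hC free1 _ _ coneS).
    by move=> i; rewrite z1E; apply: z1h; rewrite dhomogX /= mdeg1.
  by move=> h; rewrite -(PsK h).
have [al0 [cal0 al00]] : exists a, cd (a \mPo z1) /\ a != 0.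
  apply: contrapT => H1; apply: nfree1 => a ca; apply/eqP/negPn/negP => a0.
  by apply: H1; exists a.
(* A second normalization, inside the n + 2 base variables: once [al] is monic in the last of them,
   n + 1 variables suffice for integrality modulo the conductor. *)
have [T2 [c2 [uT2 c20 mal]]] := monic_coordinates al00.
pose al := c2 *: (al0 \mPo linear_forms T2).
have [Ps2 [Th2 [ThK2 PsK2 Ps2E Th2E]]] :
  exists (Ps2 : {rmorphism {mpoly K[n.+3]} -> {poly {mpoly K[n.+2]}}})
         (Th2 : {rmorphism {poly {mpoly K[n.+2]}} -> {mpoly K[n.+3]}}),
  [/\ cancel Th2 Ps2, cancel Ps2 Th2,
      forall g, Ps2 g = map_poly (comp_mpoly (linear_forms T2)) (Ps g)
    & forall p, Th2 p = Th (map_poly (comp_mpoly (linear_forms (invmx T2))) p)].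
  exists (map_poly (comp_mpoly (linear_forms T2)) \o Ps).
  exists (Th \o map_poly (comp_mpoly (linear_forms (invmx T2)))); split=> // p.
    rewrite /= ThK -map_poly_comp map_poly_id // => a _ /=.
    by rewrite comp_linearKV.
  rewrite /= -map_poly_comp map_poly_id ?PsK // => a _ /=.
  by rewrite comp_linearK.
pose f2 := map_poly (comp_mpoly (linear_forms T2)) f.
have Th2f : Th2 f2 = Th f.
  rewrite Th2E -map_poly_comp map_poly_id // => a _ /=.
  by rewrite comp_linearK.
have mf2 : f2 \is monic by apply: monic_map.
have Th2C a : Th2 a%:P = Th (a \mPo linear_forms (invmx T2))%:P.
  by rewrite Th2E map_polyC.
have cdal : cd (Th2 al%:P).
  rewrite Th2C /al comp_mpolyZ comp_linearK // -Thz comp_mpolyZ -mul_mpolyC.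
  exact: ideal_mull.
have [z2 z2E] : exists z2 : n.+1.-tuple _, forall i, tnth z2 i = Th2 ('X_(wid i))%:P.
  by exists [tuple Th2 ('X_(wid i))%:P | i < n.+1] => i; rewrite tnth_mktuple.
have Thz2 b : b \mPo z2 = Th2 (mwiden b)%:P.
  elim/mpoly_gen_ind: b => [c|i|p q IHp IHq|p q IHp IHq].
  - by rewrite comp_mpolyC mwidenC Th2C comp_mpolyC ThC.
  - by rewrite comp_mpolyXU -tnth_nth z2E mwidenX_widen.
  - by rewrite comp_mpolyD mwidenD polyCD (rmorphD Th2); congr (_ + _); [exact: IHp|exact: IHq].
  - by rewrite (rmorphM (comp_mpoly z2)) mwidenM polyCM (rmorphM Th2); congr (_ * _); [exact: IHp|exact: IHq].
pose et : {rmorphism {poly {mpoly K[n.+1]}} -> {mpoly K[n.+3]}} :=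
  Th2 \o polyC \o @of_muni n.+1 K.
have intA a : integral_over_mod (comp_mpoly z2) cd (Th2 a%:P).
  have := @integral_over_mod_poly _ _ _ (comp_mpoly z2) et cd _ hC mal.
  rewrite -[X in Th2 X%:P](muniK a) -/(et (muni a)); apply.
    by rewrite /et /= muniK.
  move=> b; rewrite /et /= of_muniC -Thz2.
  exact: (integral_over_mod_base (comp_mpoly z2) hC).
have int2 p : integral_over_mod (comp_mpoly z2) cd (Th2 p).
  by apply: (integral_over_mod_poly hC mf2 _ intA); rewrite Th2f.
have [free2|nfree2] := pselect (forall b, cd (b \mPo z2) -> b = 0).
  case: (noC n) => //; apply: (@integral_free_chain K _ _ z2 _ cd hC free2 _ _ coneS).
    move=> i; rewrite z2E Th2C; apply: z1h.
    apply: dhomog_comp => [j|]; first exact: linear_forms_homog.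
    by rewrite dhomogX /= mdeg1.
  by move=> h; rewrite -(PsK2 h).
have [be [cbe be0]] : exists b, cd (b \mPo z2) /\ b != 0.
  apply: contrapT => H1; apply: nfree2 => b cb; apply/eqP/negPn/negP => b0.
  by apply: H1; exists b.
have fE2 : Th2 f2 = c1%:MP * F by rewrite Th2f.
have FE2 : F = (c1^-1)%:MP * Th2 f2 by rewrite Th2f.
have pf2 := iso_prime ThK2 PsK2 fE2 FE2 pF.
have nfH2 : ~ dvds f2 (Ps2 H) by move/(iso_dvds ThK2 PsK2 fE2 FE2).
have cdP a : cd (Th2 a%:P) -> conductor f2 (Ps2 H) (Ps2 G) a%:P.
  by move/(iso_comb ThK2 PsK2 fE2 FE2); rewrite rmorphM ThK2.
apply/(iso_comb ThK2 PsK2 fE2 FE2).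
(* The pair is regular because [al] is monic in a variable that [be] does not involve. *)
apply: (@regular_pair_in_conductor _ f2 (Ps2 G) (Ps2 H) al (mwiden be)) => //.
- by apply: contra_neq be0 => b0; apply: (@inj_mwiden _ _); rewrite b0 mwiden0.
- move=> a b E; have [|q qE] := @monic_const_regular _ (muni al) be (muni a) (muni b) mal.
    by rewrite -!muniM E muniM muni_mwiden.
  by exists (of_muni q); rewrite -[b]muniK qE of_muniM of_muniC.
- exact: cdP.
- by apply: cdP; rewrite -Thz2.
Qed.

(** * Linearity of the Galois conjugates *)

Lemma pihomogM (R : idomainType) (n D j : nat) (P H : {mpoly R[n]}) : H \is j.-homog ->
  pihomog mdeg D (P * H) = if (j <= D)%N then pihomog mdeg (D - j) P * H else 0.
Proof.
move=> hH.
have E i : pihomog mdeg D (pihomog mdeg i P * H) =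
    if (i + j == D)%N then pihomog mdeg i P * H else 0.
  have hPH : pihomog mdeg i P * H \is (i + j).-homog.
    by apply: dhomogM => //; apply: pihomogP.
  case: eqP => [<-|/eqP ne]; first exact: pihomog_dE.
  exact: pihomog_ne0 ne hPH.
pose k := (msize P + D).+1.
have sP : (msize P <= k)%N by rewrite /k; lia.
rewrite {1}(pihomog_partitionE sP) mulr_suml raddf_sum /=.
under eq_bigr => i _ do rewrite E.
case: leqP => jD; last first.
  rewrite big1 // => i _; case: eqP => // iD.
  by move: jD; rewrite -iD ltnNge leq_addl.
have lt_k : (D - j < k)%N by rewrite /k; lia.
rewrite (bigD1 (Ordinal lt_k)) //= subnK // eqxx big1 ?addr0 // => i.
rewrite -val_eqE /= => ne; case: eqP => // iD.
by case/eqP: ne; rewrite -iD addnK.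
Qed.

Lemma dvds_pihomog (R : idomainType) (n d D : nat) (F x : {mpoly R[n]}) :
  F \is d.-homog -> dvds F x -> dvds F (pihomog mdeg D x).
Proof.
move=> hF [Q ->]; rewrite (pihomogM _ _ hF); case: ifP => _.
  by exists (pihomog mdeg (D - d) Q).
by exists 0; rewrite mul0r.
Qed.

Lemma dvds_small (K : fieldType) (n : nat) (F g : {mpoly K[n.+1]}) :
  (size (muni g) < size (muni F))%N -> dvds F g -> g = 0.
Proof.
move=> sg [Q gE]; apply: (can_inj (@muniK n K)); rewrite muni0.
move: (congr1 (@muni n K) gE) sg; rewrite muniM.
move: (muni g) (muni Q) (muni F) => {gE F Q}g Q F -> sg.
apply/eqP; apply: contraTT isT => g0; move: sg; rewrite ltnNge => /negP[].
have [Q0 F0] : Q != 0 /\ F != 0 by move: g0; rewrite mulf_eq0 negb_or => /andP.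
rewrite size_mul //; move: Q0; rewrite -size_poly_gt0.
by case: (size Q) => // s _; rewrite leq_addl.
Qed.

Lemma homog1_expand (R : idomainType) (n : nat) (L : {mpoly R[n]}) :
  L \is 1.-homog -> L = \sum_i L@_U_(i) *: 'X_i.
Proof.
move=> hL; apply/mpolyP => m; rewrite raddf_sum /=.
under eq_bigr => i _ do rewrite mcoeffZ mcoeffX.
have [/eqP/mdeg1P[j /eqP ->]|m1] := eqVneq (mdeg m) 1%N.
  rewrite (bigD1 j) //= eqxx mulr1 big1 ?addr0 // => i ij.
  by rewrite eq_mnm1 (negbTE ij) mulr0.
rewrite (dhomog_nemf_coeff hL) // big1 // => i _.
case: eqP => [E|]; last by rewrite mulr0.
by move: m1; rewrite -E mdeg1.
Qed.

(** Eliminating a variable that occurs in [L] realizes reduction modulo [L] as an endomorphism, so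
    that computations modulo [L] stay in a polynomial ring. *)
Lemma linear_form_retraction (K : fieldType) (n : nat) (L : {mpoly K[n]}) :
  L \is 1.-homog -> L != 0 ->
  exists rho : {rmorphism {mpoly K[n]} -> {mpoly K[n]}},
  [/\ rho L = 0, forall g, dvds L (g - rho g) & forall c, rho c%:MP = c%:MP].
Proof.
move=> hL L0.
have [j aj] : exists j, L@_U_(j) != 0.
  apply: contrapT => H; case/eqP: L0; rewrite (homog1_expand hL) big1 // => i _.
  by have [->|ai] := eqVneq (L@_U_(i)) 0; [rewrite scale0r|case: H; exists i].
pose t := [tuple 'X_i - (if i == j then (L@_U_(j))^-1 *: L else 0) | i < n].
have tX i : 'X_i \mPo t = 'X_i - (if i == j then (L@_U_(j))^-1 *: L else 0).
  by rewrite comp_mpolyXU -tnth_nth tnth_mktuple.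
exists (comp_mpoly t); split=> [|g|c]; last exact: comp_mpolyC.
  rewrite {1}(homog1_expand hL) raddf_sum /=.
  under eq_bigr => i _ do rewrite comp_mpolyZ tX scalerBr.
  rewrite sumrB -(homog1_expand hL) (bigD1 j) //= eqxx scalerA mulfV // scale1r.
  by rewrite big1 ?addr0 ?subrr // => i /negbTE ->; rewrite scaler0.
elim/mpoly_gen_ind: g => [c|i|p q IHp IHq|p q IHp IHq].
- by rewrite /= comp_mpolyC subrr; exists 0; rewrite mul0r.
- rewrite /= tX opprB addrCA subrr addr0; case: eqP => _; last by exists 0; rewrite mul0r.
  by exists ((L@_U_(j))^-1)%:MP; rewrite mul_mpolyC.
- by rewrite /= comp_mpolyD opprD addrACA; apply: dvdsD.
- rewrite /= rmorphM /=; have -> : p * q - (p \mPo t) * (q \mPo t) =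
    q * (p - (p \mPo t)) + (p \mPo t) * (q - (q \mPo t)) by ring.
  by apply: dvdsD; apply: dvds_mull.
Qed.

(* Only one root of [X^(m-1) (X + a)] is not multiple. *)
Lemma affine_symmetry_fixes0 (B : idomainType) (m : nat) (a c q : B) :
  (2 < m)%N -> c != 0 ->
  (c *: 'X + q%:P) ^+ m.-1 * (c *: 'X + (q + a)%:P) =
    c ^+ m *: ('X^(m.-1) * ('X + a%:P)) -> q = 0.
Proof.
case: m => [|[|[|m]]] //= _ c0 E; apply/eqP; apply: contraTT isT => q0.
have := congr1 (fun p => p.[0]) E.
rewrite hornerM horner_exp !hornerD hornerZ hornerX !hornerC mulr0 !add0r.
rewrite hornerZ hornerM hornerXn expr0n mul0r mulr0 => /eqP.
rewrite mulf_eq0 expf_eq0 /= (negbTE q0) /= => /eqP qa.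
move: E; rewrite qa polyC0 addr0 -mul_polyC => E.
have {}E : (c%:P * 'X + q%:P) ^+ m.+2 * c%:P = c ^+ m.+3 *: ('X^(m.+1) * ('X + a%:P)).
  apply: (mulIf (negbT (polyX_eq0 B))); rewrite -mulrA E -!scalerAl; congr (_ *: _).
  by rewrite [_ ^+ m.+2]exprSr mulrAC.
(* After cancelling ['X] the right side still has the factor ['X] to the original m - 2, positive as
   m > 2. For m = 2 an affine map could exchange the two roots. *)
have := congr1 (fun p => p.[0]) E.
rewrite hornerM horner_exp !hornerD hornerM !hornerC hornerX mulr0 add0r.
rewrite hornerZ hornerM hornerXn expr0n mul0r mulr0 => /eqP.
by rewrite mulf_eq0 expf_eq0 /= (negbTE q0) (negbTE c0).
Qed.

Section MonicTransform.
Variables (A : idomainType) (f : {poly A}) (m : nat).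
Hypotheses (sf : size f = m.+1) (m_gt0 : (0 < m)%N).
Let a := lead_coef f.

(* [a ^ (m - 1) f (X / a)], the equation of [a x] for a root [x] of [f]. *)
Definition monic_transform : {poly A} :=
  \poly_(i < m.+1) (if i == m then 1 else lead_coef f ^+ (m.-1 - i) * f`_i).

Lemma coef_monic_transform i : (i < m)%N ->
  monic_transform`_i = a ^+ (m.-1 - i) * f`_i.
Proof. by move=> im; rewrite coef_poly ltnS ltnW // ltn_eqF. Qed.

Lemma coef_monic_transform_lead : monic_transform`_m = 1.
Proof. by rewrite coef_poly ltnSn eqxx. Qed.

Lemma size_monic_transform : size monic_transform = m.+1.
Proof. by rewrite size_poly_eq // eqxx oner_neq0. Qed.

Lemma monic_transform_monic : monic_transform \is monic.
Proof.
by rewrite monicE lead_coefE size_monic_transform coef_monic_transform_lead.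
Qed.

Lemma comp_monic_transform : monic_transform \Po (a *: 'X) = a ^+ m.-1 *: f.
Proof.
apply/polyP => i; rewrite coefZ comp_polyE size_monic_transform coef_sum.
under eq_bigr => j _ do rewrite exprZn coefZ coefZ coefXn.
case: (ltnP i m.+1) => im; last first.
  rewrite nth_default ?sf // mulr0 big1 // => j _.
  by rewrite (_ : _ == _ = false) ?mulr0 //; apply/negbTE; have := ltn_ord j; lia.
rewrite (bigD1 (Ordinal im)) //= eqxx mulr1 big1 ?addr0 => [|j ij]; last first.
  by rewrite -val_eqE /= eq_sym in ij; rewrite (negbTE ij) !mulr0.
move: im; rewrite ltnS leq_eqVlt => /orP[/eqP ->|im].
  rewrite coef_monic_transform_lead mul1r /a lead_coefE sf /= -exprSr prednK //.
rewrite coef_monic_transform // mulrAC -exprD; congr (_ ^+ _ * _); lia.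
Qed.

End MonicTransform.

Section ConjugateForm.
Variables (K : fieldType) (n m dl : nat) (f : {poly {mpoly K[n]}}).
Hypotheses (sf : size f = m.+1) (m_gt2 : (2 < m)%N) (dl_le1 : (dl <= 1)%N).
Hypothesis f_homog : forall i, f`_i \is (m + dl - i).-homog.
Let a := lead_coef f.
Let p := monic_transform f m.

Let a_homog : a \is dl.-homog.
Proof. by rewrite /a lead_coefE sf /=; have := f_homog m; rewrite addnC addnK. Qed.

Let a0 : a != 0.
Proof. by rewrite lead_coef_eq0 -size_poly_gt0 sf. Qed.

(** [dl] is the degree of [a], so [a x] has weight dl + 1, and its equation is homogeneous for that
    weight. *)
Lemma monic_transform_homog i : (i <= m)%N ->
  p`_i \is ((m - i) * dl.+1).-homog.
Proof.
rewrite leq_eqVlt => /orP[/eqP ->|im].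
  by rewrite coef_monic_transform_lead subnn mul0n dhomog1.
rewrite coef_monic_transform //.
have -> : ((m - i) * dl.+1 = dl * (m.-1 - i) + (m + dl - i))%N by nia.
by apply: dhomogM => //; apply: dhomogMn.
Qed.

Variable q : {poly {mpoly K[n]}}.
Hypotheses (q_homog : forall i, q`_i \is (dl.+1 - i).-homog).
Hypotheses (sq_gt1 : (1 < size q)%N) (sq_le : (size q <= dl.+2)%N).
Hypothesis f_dvd : dvds f (p \Po q).

Let retraction (dl1 : dl = 1%N) : exists rho : {rmorphism {mpoly K[n]} -> {mpoly K[n]}},
  [/\ rho a = 0, forall g, dvds a (g - rho g) & forall c, rho c%:MP = c%:MP].
Proof. by apply: linear_form_retraction a0; rewrite -dl1. Qed.

Let dvds_a k g : dvds a g -> g \is (dl + k).-homog ->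
  exists2 s, s \is k.-homog & g = s * a.
Proof.
move=> [s gE] hg; exists (pihomog mdeg k s); first exact: pihomogP.
by rewrite -(pihomog_dE hg) gE (pihomogM _ _ a_homog) leq_addr addKn.
Qed.

Let a_const : dl = 0%N -> exists2 b : K, b != 0 & a = b%:MP.
Proof.
move=> dl0; have ha := a_homog; rewrite dl0 in ha.
have aE := dhomog0_const ha; exists a@_0%MM => //.
by apply: contra_neq a0 => b0; rewrite aE b0 mpolyC0.
Qed.

(** When [dl] is 1, comparing leading coefficients in [p \Po q = Q * f] shows that [a] divides that
    of [q]. This excludes degree 2 in [x], where the leading coefficient is a nonzero constant. *)
Lemma conjugate_slope : size q = 2 /\ exists2 c : K, c != 0 & q`_1 = c%:MP * a.
Proof.
have lq0 : lead_coef q != 0 by rewrite lead_coef_eq0 -size_poly_gt0 ltnW.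
have [dl0|dl1] : dl = 0%N \/ dl = 1%N by lia.
  have sq2 : size q = 2 by apply/eqP; rewrite eqn_leq sq_gt1 andbT; have := sq_le; rewrite dl0.
  split=> //; have [b b0 aE] := a_const dl0.
  have := q_homog 1; rewrite dl0 => /dhomog0_const qE.
  exists (q`_1@_0%MM / b); last by rewrite aE -mpolyCM divfK // -qE.
  rewrite mulf_neq0 ?invr_eq0 //; apply: contra_neq lq0 => E.
  by rewrite lead_coefE sq2 /= qE E mpolyC0.
have [rho [rhoa dvd_rho rhoC]] := retraction dl1.
have aq : dvds a (lead_coef q).
  have := dvd_rho (lead_coef q).
  have -> : rho (lead_coef q) = 0; last by rewrite subr0.
  have [Q QE] := f_dvd; have := congr1 (fun r => rho (lead_coef r)) QE.
  rewrite lead_coef_comp // (monicP (monic_transform_monic _ _)) mul1r.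
  rewrite lead_coefM -/a rmorphM rhoa mulr0 rmorphXn => /eqP.
  by rewrite expf_eq0 => /andP[_ /eqP].
have [sq2|sq2] := eqVneq (size q) 2.
  split=> //; move: aq lq0; rewrite lead_coefE sq2 /= => aq lq0.
  have [|s hs sE] := dvds_a (k := 0) aq.
    by have := q_homog 1; rewrite dl1.
  exists s@_0%MM; last by rewrite -(dhomog0_const hs).
  by apply: contra_neq lq0 => E; rewrite sE (dhomog0_const hs) E mpolyC0 mul0r.
have sq3 : size q = 3 by move: sq_le sq_gt1 sq2; rewrite dl1; lia.
move: aq lq0; rewrite lead_coefE sq3 /= => [[s sE]] /eqP[].
have := q_homog 2; rewrite dl1 /= => /dhomog0_const qE.
have := congr1 rho sE; rewrite qE rhoC rmorphM rhoa mulr0 -qE.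
by [].
Qed.

(** The remaining point is that [a] divides [q]_0[. As]f[and]p \Po q[have the same degree, they are
    proportional over]A[; cancelling the substitution of]a
    x[turns this into invariance of]p[, up to]c ^+ m[, under the affine map]c 'X + q[_0], which is
    then reduced modulo [a]. *)
Lemma conjugate_form : exists (c : K) (s : {mpoly K[n]}),
  [/\ c != 0, s \is 1.-homog & q = a *: (c%:MP *: 'X + s%:P)].
Proof.
have [sq2 [c c0 q1]] := conjugate_slope.
have qE : q = (c%:MP *: 'X + (q`_0)%:P) \Po (a *: 'X).
  rewrite comp_polyD comp_polyZ comp_polyX comp_polyC scalerA -q1.
  apply/polyP => i; rewrite coefD coefZ coefX coefC.
  case: i => [|[|i]]; rewrite ?mulr0 ?add0r ?mulr1 ?addr0 //.
  by rewrite nth_default // sq2.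
have cM0 : c%:MP != 0 :> {mpoly K[n]} by rewrite mpolyC_eq0.
have m_gt0 : (0 < m)%N by lia.
have [s hs q0E] : exists2 s, s \is 1.-homog & q`_0 = s * a.
  apply: dvds_a; last by rewrite addn1.
  have [dl0|dl1] : dl = 0%N \/ dl = 1%N by lia.
    have [b b0 ->] := a_const dl0; exists (q`_0 * (b^-1)%:MP).
    by rewrite -mulrA -mpolyCM mulVf // mpolyC1 mulr1.
  have [rho [rhoa dvd_rho rhoC]] := retraction dl1.
  suff r0 : rho q`_0 = 0 by have := dvd_rho q`_0; rewrite r0 subr0.
  have E : p \Po (c%:MP *: 'X + (q`_0)%:P) = (c%:MP) ^+ m *: p.
    have inj_a (r1 r2 : {poly {mpoly K[n]}}) : r1 \Po (a *: 'X) = r2 \Po (a *: 'X) -> r1 = r2.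
      move/eqP; rewrite -subr_eq0 -comp_polyB comp_poly2_eq0.
        by rewrite subr_eq0 => /eqP.
      by rewrite size_scale // size_polyX.
    apply: inj_a; rewrite -comp_polyA -qE comp_polyZ (comp_monic_transform sf m_gt0) -/a.
    have [Q QE] := f_dvd; rewrite QE.
    have sQ : size Q = 1%N.
      have := congr1 (fun r : {poly _} => size r) QE.
      rewrite size_comp_poly2 // (size_monic_transform f).
      have f0 : f != 0 by rewrite -size_poly_gt0 sf.
      have Q0 : Q != 0.
        apply/eqP => Q0; move/eqP: QE; rewrite Q0 mul0r comp_poly2_eq0 //.
        by rewrite (negbTE (monic_neq0 (monic_transform_monic _ _))).
      rewrite size_mul // sf addnS /=.
      by move: Q0; rewrite -size_poly_gt0; move: (size Q) => t; lia.
    have [u u0 QuE] : exists2 u, u != 0 & Q = u%:P.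
      by have /eqP/size_poly1P := sQ.
    rewrite QuE mul_polyC scalerA; congr (_ *: _); apply: (mulIf a0).
    have := congr1 (fun r => lead_coef r) QE.
    rewrite lead_coef_comp // (monicP (monic_transform_monic _ _)) mul1r.
    rewrite QuE mul_polyC lead_coefZ -/a size_monic_transform /= => <-.
    rewrite lead_coefE sq2 /= q1 exprMn -mulrA -exprSr prednK //.
  (* Every coefficient of [p] of index below m - 1 contains a positive power of [a], which [rho]
     kills. *)
  have pr : map_poly rho p = 'X^(m.-1) * ('X + (rho f`_m.-1)%:P).
    apply/polyP => i; rewrite coef_map mulrDr coefD -exprSr prednK // coefXn coefMC coefXn.
    have [im|im] := ltnP i m; last first.
      move: im; rewrite leq_eqVlt => /orP[/eqP <-|im].
        rewrite coef_monic_transform_lead [X in X = _](rmorph1 rho) eqxx.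
        by rewrite gtn_eqF ?prednK // mul0r addr0.
      rewrite nth_default ?size_monic_transform // [X in X = _](rmorph0 rho).
      by rewrite !gtn_eqF ?(leq_ltn_trans (leq_pred m)) // mul0r addr0.
    rewrite coef_monic_transform // -/a [X in X = _](rmorphM rho) (rmorphXn rho) rhoa.
    rewrite (ltn_eqF im) add0r.
    have [->|ne] := eqVneq i m.-1; first by rewrite subnn expr0.
    rewrite expr0n subn_eq0 leqNgt ltn_neqAle ne -ltnS prednK // im.
    by rewrite !mul0r.
  apply: (@affine_symmetry_fixes0 _ m (rho f`_m.-1) (rho c%:MP) _ m_gt2).
    by rewrite rhoC.
  have := congr1 (map_poly rho) E; rewrite map_comp_poly map_polyZ pr.
  rewrite rmorphD /= map_polyZ map_polyX map_polyC /= rmorphXn.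
  by rewrite comp_polyM comp_polyD comp_Xn_poly comp_polyX comp_polyC polyCD addrA.
exists c, s; split=> //; rewrite scalerDr scalerA [a * c%:MP]mulrC -q1 -(mul_polyC a s%:P) -polyCM [a * s]mulrC -q0E.
apply/polyP => i; rewrite coefD coefZ coefX coefC.
case: i => [|[|i]]; rewrite ?mulr0 ?add0r ?mulr1 ?addr0 //.
by rewrite nth_default // sq2.
Qed.

End ConjugateForm.

Section GaloisConjugates.
Variables (K : fieldType) (n m dl : nat) (F : {mpoly K[n.+2]}).
Hypotheses (sf : size (muni F) = m.+1) (m_gt2 : (2 < m)%N) (dl_le1 : (dl <= 1)%N).
Hypotheses (hF : F \is (m + dl).-homog).
Hypothesis normF : forall G H, ~ dvds F H -> integral_mod F G H -> comb F H G.
Variables (Phi : fieldType) (ev : {rmorphism {mpoly K[n.+2]} -> Phi}).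
Hypothesis ev_ker : forall g, ev g = 0 <-> dvds F g.
Variables (k : fieldType) (L : splittingFieldType k) (emb : {rmorphism L -> Phi}).
Hypothesis emb_top : forall x, (exists a, x = emb a) <->
  exists j G H, [/\ G \is j.-homog, H \is j.-homog, ev H != 0 & x = ev G / ev H].
Hypothesis emb_base : forall x, (exists c : k, x = emb c%:A) <->
  exists j g h, [/\ g \is j.-homog, h \is j.-homog, ev (mwiden h) != 0
    & x = ev (mwiden g) / ev (mwiden h)].

Lemma ev_small g : (size (muni g) <= m)%N -> ev g = 0 -> g = 0.
Proof.
move=> sg /ev_ker; apply: dvds_small.
exact: leq_trans (_ : size (muni g) < m.+1)%N (eq_leq (esym sf)).
Qed.

Lemma ev_mwiden_eq0 (g : {mpoly K[n.+1]}) : (ev (mwiden g) == 0) = (g == 0).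
Proof.
apply/eqP/eqP => [|->]; last by rewrite mwiden0 rmorph0.
move/ev_small => E; apply: (@inj_mwiden n.+1 K); rewrite mwiden0 E //.
by rewrite muni_mwiden (leq_trans (size_polyC_leq1 _)) // ltnW // ltnW.
Qed.

(** Function fields consist of fractions of degree 0; dividing a form of degree j by [y ^+ j] brings
    it there. *)
Let y := ev (mwiden 'X_ord0).

Lemma y_neq0 : y != 0.
Proof. by rewrite ev_mwiden_eq0 -msize_poly_eq0 msizeX. Qed.

Lemma X0_homog j : ('X_ord0 : {mpoly K[n.+1]}) ^+ j \is j.-homog.
Proof.
by have := dhomogMn j (_ : 'X_ord0 \is 1.-homog); rewrite mul1n; apply;
   rewrite dhomogX /= mdeg1.
Qed.

Lemma base_scalar j g : g \is j.-homog ->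
  exists c : k, emb c%:A = ev (mwiden g) / y ^+ j.
Proof.
move=> hg; have [_ H] := emb_base (ev (mwiden g) / y ^+ j).
have [|c cE] := H; last by exists c.
exists j, g, ('X_ord0 ^+ j); split=> //; first exact: X0_homog.
  by rewrite ev_mwiden_eq0 expf_neq0 // -msize_poly_eq0 msizeX.
by rewrite rmorphXn /= rmorphXn.
Qed.

Lemma theta_exists : exists th, emb th = ev 'X_ord_max / y.
Proof.
have [_ H] := emb_top (ev 'X_ord_max / y); have [|a aE] := H; last by exists a.
exists 1%N, 'X_ord_max, (mwiden 'X_ord0); split=> //; rewrite ?y_neq0 //.
  by rewrite dhomogX /= mdeg1.
by apply: mwiden_homog; rewrite dhomogX /= mdeg1.
Qed.

Variable th : L.
Hypothesis thE : emb th = ev 'X_ord_max / y.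

Lemma ev_of_muni (r : {poly {mpoly K[n.+1]}}) s : (size r <= s)%N ->
  ev (of_muni r) = \sum_(i < s) ev (mwiden r`_i) * ev 'X_ord_max ^+ i.
Proof.
move=> sr; rewrite /of_muni (horner_coef_wide _ (n := s)); last first.
  by rewrite (leq_trans (size_poly _ _)).
rewrite rmorph_sum; apply: eq_bigr => i _.
by rewrite coef_map rmorphM rmorphXn.
Qed.

(** With [th = x / y], powers of [x] become powers of [th], and the coefficients, forms of [A]
    divided by powers of [y], become elements of the base field. *)
Lemma dehomogenize j G : G \is j.-homog -> exists P : {poly k},
  [/\ emb (map_poly (GRing.in_alg L) P).[th] = ev G / y ^+ j,
      (size P <= size (muni G))%N & G != 0 -> P != 0].
Proof.
move=> hG; set s := size (muni G).
have sj : (s <= j.+1)%N by apply: size_muni_homog hG.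
have : forall i, exists c : k, emb c%:A = ev (mwiden (muni G)`_i) / y ^+ (j - i).
  by move=> i; apply: base_scalar; apply: muni_homog.
move=> /choice[b bE]; exists (\poly_(i < s) b i); split.
- rewrite (horner_coef_wide _ (n := s)); last first.
    by rewrite (leq_trans (size_poly _ _)) ?size_poly.
  rewrite rmorph_sum -[in RHS](muniK G) (@ev_of_muni _ s) // mulr_suml.
  apply: eq_bigr => i _; rewrite coef_map coef_poly ltn_ord rmorphM rmorphXn /= bE thE.
  have -> : y ^+ j = y ^+ (j - i) * y ^+ i.
    by rewrite -exprD subnK // -ltnS (leq_trans (ltn_ord i)).
  by rewrite expr_div_n mulf_div.
- exact: size_poly.
move=> G0; apply: contra_neq G0 => P0; apply: (can_inj (@muniK _ K)); rewrite muni0.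
apply/eqP; rewrite -size_poly_eq0 -/s; case Es: s => [//|t].
have := congr1 (fun P : {poly k} => P`_t) P0; rewrite coef_poly Es ltnSn coef0 => bt.
have := bE t; rewrite bt scale0r rmorph0 => /esym/eqP.
rewrite mulf_eq0 invr_eq0 expf_eq0 (negbTE y_neq0) andbF orbF ev_mwiden_eq0.
have -> : (muni G)`_t = lead_coef (muni G) by rewrite lead_coefE -/s Es.
by rewrite lead_coef_eq0 -size_poly_eq0 -/s Es.
Qed.

Lemma theta_generates : <<1%AS; th>>%AS = {:L}%AS :> {vspace L}.
Proof.
have polyK (P : {poly k}) : (map_poly (GRing.in_alg L) P).[th] \in <<1%AS; th>>%AS.
  apply: rpred_horner; last exact: memv_adjoin.
  by apply/polyOverP => i; rewrite coef_map /=; apply: rpredZ; apply: rpred1.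
apply/eqP; rewrite eqEsubv subvf; apply/subvP => x _.
have [|j [G [H [hG hH H0 xE]]]] := (emb_top (emb x)).1; first by exists x.
have [P [PE _ _]] := dehomogenize hG; have [Q [QE _ _]] := dehomogenize hH.
have -> : x = (map_poly (GRing.in_alg L) P).[th] / (map_poly (GRing.in_alg L) Q).[th].
  apply: (fmorph_inj emb); rewrite fmorph_div /= PE QE xE.
  by rewrite invf_div mulrA divfK // expf_neq0 // y_neq0.
by apply: rpred_div; apply: polyK.
Qed.

(** [F] itself gives an equation of degree m. Conversely, a shorter equation, cleared of
    denominators, would be a nonzero multiple of [F] of smaller degree in [x]. *)
Lemma theta_degree : adjoin_degree 1%AS th = m.
Proof.
have F0 : F != 0.
  by apply/eqP => F0; move: sf; rewrite F0 muni0 size_poly0.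
apply/eqP; rewrite eqn_leq; apply/andP; split.
  have [P [PE sP P0]] := dehomogenize hF.
  rewrite -ltnS -size_minPoly -sf (leq_trans _ sP) //.
  rewrite -(size_map_poly (GRing.in_alg L) P); apply: dvdp_leq.
    by rewrite map_poly_eq0 P0.
  apply: minPoly_dvdp.
    by apply/polyOverP => i; rewrite coef_map /=; apply: rpredZ; apply: rpred1.
  rewrite rootE -(fmorph_eq0 emb) PE.
  have -> : ev F = 0 by apply/ev_ker; exists 1; rewrite mul1r.
  by rewrite mul0r.
have /polyOver1P[P PE] := minPolyOver 1%AS th.
set s := adjoin_degree _ _; have sP : size P = s.+1.
  by rewrite -(size_map_poly (GRing.in_alg L)) -PE size_minPoly.
rewrite leqNgt; apply/negP => lt_sm.
have : forall i, exists gh : {mpoly K[n.+1]} * {mpoly K[n.+1]},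
    ev (mwiden gh.2) != 0 /\ emb (P`_i)%:A = ev (mwiden gh.1) / ev (mwiden gh.2).
  move=> i; have [|j [g [h [_ _ h0 E]]]] := (emb_base (emb (P`_i)%:A)).1.
    by exists P`_i.
  by exists (g, h).
move=> /choice[gh ghE].
(* The coefficients are multiplied by the product of all denominators, and the powers of [x / y] by
   [y ^+ s]. *)
pose cof i : {mpoly K[n.+1]} := \prod_(l < s.+1 | val l != i) (gh l).2.
pose r := \poly_(i < s.+1) ((gh i).1 * cof i * 'X_ord0 ^+ (s - i)).
have cofE (i : 'I_s.+1) : ev (mwiden (gh i).2) * ev (mwiden (cof i)) =
    ev (mwiden (\prod_(l < s.+1) (gh l).2)).
  rewrite [X in _ = ev (mwiden X)](bigD1 i) //= (mwidenM (gh i).2) rmorphM.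
  by congr (_ * ev (mwiden _)); apply: eq_bigl => l; rewrite -val_eqE.
have r0 : r = 0.
  rewrite -[r]of_muniK (@ev_small (of_muni r)) ?muni0 //.
    by rewrite of_muniK (leq_trans (size_poly _ _)).
  rewrite (@ev_of_muni r s.+1) ?size_poly //.
  have rt : root (minPoly 1%AS th) th := root_minPoly _ _.
  have {rt} := congr1 emb (rootP rt); rewrite PE rmorph0.
  rewrite (horner_coef_wide _ (n := s.+1)); last first.
    by rewrite (leq_trans (size_poly _ _)) // sP.
  rewrite rmorph_sum => E.
  rewrite -[RHS](mulr0 (ev (mwiden (\prod_(l < s.+1) (gh l).2)) * y ^+ s)) -[in RHS]E.
  rewrite mulr_sumr; apply: eq_bigr => i _.
  rewrite coef_poly ltn_ord coef_map (rmorphM emb) (rmorphXn emb) /= (ghE i).2 thE -(cofE i).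
  rewrite !mwidenM !rmorphM !rmorphXn /= -/y.
  have -> : y ^+ s = y ^+ (s - i) * y ^+ i by rewrite -exprD subnK // -ltnS.
  rewrite expr_div_n; move: (ghE i).1 (expf_neq0 i y_neq0).
  move: (ev (mwiden (gh i).2)) (ev (mwiden (gh i).1)) (ev (mwiden (cof i))).
  move: (y ^+ i) (y ^+ (s - i)) (ev 'X_ord_max ^+ i) => yi ys x h2 h1 w h20 yi0.
  by field; rewrite h20 yi0.
have := congr1 (fun q : {poly {mpoly K[n.+1]}} => q`_s) r0.
rewrite coef_poly ltnSn coef0 subnn expr0 mulr1 => /eqP; rewrite mulf_eq0.
have nz i : (gh i).2 != 0 by rewrite -ev_mwiden_eq0 (ghE i).1.
rewrite orbC (negbTE (_ : cof s != 0)) /=; last first.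
  by apply/prodf_neq0 => l _; apply: nz.
move=> /eqP g0; have := (ghE s).2; rewrite g0 mwiden0 rmorph0 mul0r => /eqP.
rewrite fmorph_eq0 scaler_eq0 oner_eq0 orbF.
have -> : P`_s = lead_coef P by rewrite lead_coefE sP.
by rewrite lead_coef_eq0 -size_poly_eq0 sP.
Qed.

Lemma ev_comp_poly (p q : {poly {mpoly K[n.+1]}}) s : (size p <= s)%N ->
  ev (of_muni (p \Po q)) = \sum_(i < s) ev (mwiden p`_i) * ev (of_muni q) ^+ i.
Proof.
move=> sp; rewrite /comp_poly (horner_coef_wide _ (n := s)); last first.
  by rewrite (leq_trans (size_poly _ _)).
rewrite (raddf_sum (@of_muni _ K)) raddf_sum; apply: eq_bigr => i _.
rewrite coef_map /= of_muniM of_muniC rmorphM.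
by rewrite (rmorphXn (@of_muni _ K)) (rmorphXn ev).
Qed.

(** The automorphism [sg] fixes the equation of [a x], scaled to degree 0, so the conjugate is again
    integral. Normality represents it by a form of degree dl + 1, to which [conjugate_form] applies;
    dividing by [a] gives the image of [th]. *)
Lemma conjugate_affine (sg : gal_of {:L}) : exists c b : k,
  c != 0 /\ sg th = c%:A * th + b%:A.
Proof.
have sgC (c : k) : sg c%:A = c%:A by apply: rmorph_alg.
have [f fE] : exists f, f = muni F by eexists.
have sf' : size f = m.+1 by rewrite fE.
have m_gt0 : (0 < m)%N by apply: ltnW; apply: ltnW.
have f_homog i : f`_i \is (m + dl - i).-homog by rewrite fE; apply: muni_homog.
have FE : F = of_muni f by rewrite fE muniK.
pose a := lead_coef f; pose p := monic_transform f m.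
have a_homog : a \is dl.-homog.
  by rewrite /a lead_coefE sf' /=; have := f_homog m; rewrite addnC addnK.
have a0 : a != 0 by rewrite lead_coef_eq0 -size_poly_gt0 sf'.
have sp : size p = m.+1 := size_monic_transform f m.
have p_homog := monic_transform_homog sf' m_gt2 dl_le1 f_homog.
have [ka kaE] := base_scalar a_homog.
have ka0 : ka%:A != 0 :> L.
  rewrite -(fmorph_eq0 emb) kaE mulf_neq0 ?invr_eq0 ?expf_neq0 ?y_neq0 //.
  by rewrite ev_mwiden_eq0.
have yD i : y ^+ i != 0 by rewrite expf_neq0 ?y_neq0.
have [b bE] : exists b : nat -> k, forall i, (i <= m)%N ->
    emb (b i)%:A = ev (mwiden p`_i) / y ^+ ((m - i) * dl.+1).
  have : forall i, exists c : k, (i <= m)%N ->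
      emb c%:A = ev (mwiden p`_i) / y ^+ ((m - i) * dl.+1).
    move=> i; case: (leqP i m) => im; last by exists 0.
    by have [c cE] := base_scalar (p_homog i im); exists c.
  by move=> /choice[b bE]; exists b.
have scale_rel (x : L) (t : Phi) : emb x = t / y ^+ dl.+1 ->
    emb (\sum_(i < m.+1) (b i)%:A * x ^+ i) =
    (\sum_(i < m.+1) ev (mwiden p`_i) * t ^+ i) / y ^+ (m * dl.+1).
  move=> xE; rewrite rmorph_sum mulr_suml; apply: eq_bigr => i _.
  rewrite rmorphM rmorphXn /= bE -1?ltnS // xE expr_div_n -exprM mulf_div.
  by rewrite -exprD [(dl.+1 * _)%N]mulnC -mulnDl subnK // -ltnS.
pose om := ka%:A * th.
have omE : emb om = ev (of_muni (a *: 'X)) / y ^+ dl.+1.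
  rewrite rmorphM /= kaE thE -mul_polyC of_muniM of_muniC of_muniX rmorphM mulf_div.
  by rewrite -exprSr.
have rel_om : \sum_(i < m.+1) (b i)%:A * om ^+ i = 0.
  apply: (fmorph_inj emb); rewrite rmorph0 (scale_rel _ _ omE).
  rewrite -(ev_comp_poly _ (eq_leq sp)) (comp_monic_transform sf' m_gt0).
  rewrite -mul_polyC of_muniM rmorphM -FE (_ : ev F = 0) ?mulr0 ?mul0r //.
  by apply/ev_ker; exists 1; rewrite mul1r.
have rel_sg : \sum_(i < m.+1) (b i)%:A * (sg om) ^+ i = 0.
  have := congr1 sg rel_om; rewrite rmorph0 rmorph_sum /= => E; rewrite -[RHS]E.
  by apply: eq_bigr => i _; rewrite [in RHS]rmorphM /= sgC rmorphXn.
have [|j [G [H [hG hH H0 sgE]]]] := (emb_top (emb (sg om))).1; first by eexists.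
(* The factor [Y] undoes the scaling to degree 0, so that [t] satisfies the equation [p] of [a x],
   with coefficients in [A]. *)
pose Y : {mpoly K[n.+2]} := mwiden ('X_ord0 ^+ dl.+1).
have YE : ev Y = y ^+ dl.+1 by rewrite /Y !rmorphXn.
have hY : Y \is (dl.+1).-homog by apply/mwiden_homog/X0_homog.
pose t := ev (Y * G) / ev H.
have sgt : emb (sg om) = t / y ^+ dl.+1.
  rewrite sgE /t rmorphM YE; move: (yD dl.+1) H0.
  by move: (y ^+ _) (ev G) (ev H) => u v w u0 w0; field; rewrite u0 w0.
have rel_t : \sum_(i < m.+1) ev (mwiden p`_i) * t ^+ i = 0.
  have := scale_rel _ _ sgt; rewrite rel_sg rmorph0 => /esym/eqP.
  by rewrite mulf_eq0 invr_eq0 (negbTE (yD _)) orbF => /eqP.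
have int_GH : integral_mod F (Y * G) H.
  exists m, (fun i => mwiden p`_i); apply/ev_ker.
  rewrite rmorphD rmorphXn rmorph_sum.
  rewrite -[RHS](mulr0 (ev H ^+ m)) -[in RHS]rel_t mulr_sumr big_ord_recr /=.
  rewrite coef_monic_transform_lead mwiden1 rmorph1 mul1r addrC; congr (_ + _).
    by rewrite /t expr_div_n mulrCA mulfV ?mulr1 // expf_neq0.
  apply: eq_bigr => i _; rewrite !rmorphM !rmorphXn.
  have -> : ev H ^+ m = ev H ^+ (m - i) * ev H ^+ i by rewrite -exprD subnK // ltnW.
  rewrite /t expr_div_n rmorphM.
  move: (expf_neq0 i H0); move: (ev H ^+ i) (ev H ^+ (m - i)) => u v u0.
  by field; rewrite u0.
have nFH : ~ dvds F H by move/ev_ker => E; rewrite E eqxx in H0.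
have [P [Q PQ]] := normF nFH int_GH.
(* Normality yields some [P], not a form; [Y * G], [H] and [F] being homogeneous, its component of
   degree dl + 1 represents [t] as well. *)
pose q' := pihomog mdeg dl.+1 P.
have tE : t = ev q'.
  have : dvds F (pihomog mdeg (dl.+1 + j) (Y * G - P * H)).
    by apply: dvds_pihomog hF _; exists Q; rewrite PQ addrC addKr.
  rewrite raddfB /= (pihomogM _ _ hH) leq_addl addnK (pihomog_dE (dhomogM hY hG)).
  move/ev_ker; rewrite rmorphB -/q' => /subr0_eq E.
  by rewrite /t E rmorphM mulfK.
pose q := muni q'.
have q'E : q' = of_muni q by rewrite muniK.
have hq' : q' \is (dl.+1).-homog := pihomogP _ _ _.
have f_dvd : dvds f (p \Po q).
  have /ev_ker[R E] : ev (of_muni (p \Po q)) = 0.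
    by rewrite (ev_comp_poly _ (eq_leq sp)) -q'E -tE.
  by exists (muni R); rewrite fE -muniM -E of_muniK.
(* Otherwise the conjugate of [om] would lie in the base field, hence so would [om] and [th],
   although [th] has degree m > 2. *)
have sq_gt1 : (1 < size q)%N.
  rewrite ltnNge; apply/negP => sq.
  have q0h : q`_0 \is (dl.+1).-homog by have := muni_homog 0 hq'; rewrite subn0.
  have [b' b'E] := base_scalar q0h.
  have : sg om = b'%:A.
    apply: (fmorph_inj emb); rewrite sgt tE b'E q'E (size1_polyC sq) of_muniC.
    by rewrite coefC.
  rewrite -sgC => /(fmorph_inj sg) omb.
  have th1 : th \in 1%AS.
    have -> : th = (ka^-1 * b') *: 1.
      by rewrite -scalerA -omb /om mulr_algl scalerK // ; apply: contra_neq ka0 => ->; rewrite scale0r.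
    by rewrite rpredZ // rpred1.
  by move: m_gt2; rewrite -theta_degree; move: th1; rewrite -adjoin_deg_eq1 => /eqP ->.
have [c [s [c0 hs qE]]] := conjugate_form sf' m_gt2 dl_le1 f_homog
  (fun i => muni_homog i hq') sq_gt1 (size_muni_homog hq') f_dvd.
have hc : (c%:MP : {mpoly K[n.+1]}) \is 0.-homog.
  by rewrite -alg_mpolyC; apply/dhomogZ/dhomog1.
rewrite -/q in qE; have [c' c'E] := base_scalar hc; have [s' s'E] := base_scalar hs.
have c'0 : c' != 0.
  apply: contra_neq c0 => c'0; move/esym/eqP: c'E.
  rewrite c'0 scale0r rmorph0 expr0 divr1 ev_mwiden_eq0 mpolyC_eq0.
  by move/eqP.
exists c', s'; split=> //; apply: (mulfI ka0); rewrite -{1}sgC -rmorphM -/om.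
apply: (fmorph_inj emb); rewrite sgt tE q'E qE rmorphM rmorphD rmorphM /=.
rewrite kaE c'E s'E thE expr0 divr1 expr1 -!mul_polyC of_muniM of_muniC.
rewrite of_muniD of_muniM !of_muniC of_muniX rmorphM rmorphD rmorphM exprSr.
move: (yD dl) y_neq0; move: (y ^+ dl) => u u0 y0.
by field; rewrite y0 u0.
Qed.

End GaloisConjugates.

(** * Finite groups of affine maps *)

Lemma pchar_root_of_unity_eq1 (k : fieldType) (p j : nat) (x : k) :
  p \in [pchar k] -> x ^+ (p ^ j) = 1 -> x = 1.
Proof.
move=> chp; elim: j => [|j IH]; first by rewrite expr1.
rewrite expnSr exprM => E; apply: IH; apply: (fmorph_inj (pFrobenius_aut chp)).
by rewrite rmorph1 -[RHS]E /= pFrobenius_autE.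
Qed.

Lemma rowspace_abelem (p e : nat) : prime p -> (p.-abelem [set: 'rV['Z_p]_e])%g.
Proof.
move=> pp; apply/(abelemP pp); split; first exact: FinRing.zmod_abelian.
move=> x _; rewrite FinRing.zmodXgE FinRing.zmod1gE; apply/rowP => i; rewrite mulmxnE !mxE.
by rewrite -mulr_natl pchar_Zp ?prime_gt1 // mul0r.
Qed.

Section AffineGroup.
Variables (k : fieldType) (L : splittingFieldType k) (th : L).
Hypothesis th_gen : <<1%AS; th>>%AS = {:L}%AS :> {vspace L}.
Hypothesis th_nbase : th \notin 1%AS.
Hypothesis affine : forall sg : gal_of {:L}, exists c b : k,
  c != 0 /\ sg th = c%:A * th + b%:A.
Local Notation gT := (gal_of {:L}).
Let G : {group gT} := 'Gal({:L} / 1)%G.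

Lemma affine_coordinates : exists (chi be : gT -> k), forall sg,
  chi sg != 0 /\ sg th = (chi sg)%:A * th + (be sg)%:A.
Proof.
have /choice[f fP] : forall sg : gT, exists cb : k * k,
    cb.1 != 0 /\ sg th = (cb.1)%:A * th + (cb.2)%:A.
  by move=> sg; have [c [b H]] := affine sg; exists (c, b).
by exists (fun sg => (f sg).1), (fun sg => (f sg).2).
Qed.

Variables (chi be : gT -> k).
Hypothesis coordE : forall sg, chi sg != 0 /\ sg th = (chi sg)%:A * th + (be sg)%:A.

Lemma affine_inj (c c' b b' : k) :
  c%:A * th + b%:A = c'%:A * th + b'%:A -> c = c' /\ b = b'.
Proof.
move/eqP; rewrite -subr_eq0 opprD addrACA -mulrBl -!scalerBl mulr_algl => /eqP E.
have cc : c = c'.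
  apply/eqP; rewrite -subr_eq0; apply: contraNT th_nbase => c0.
  have -> : th = ((c - c')^-1 * (b' - b))%:A.
    apply: (scalerI c0); rewrite scalerA mulrA mulfV // mul1r -[b' - b]opprB scaleNr.
    by apply/eqP; rewrite -addr_eq0 E.
  by rewrite rpredZ // rpred1.
split=> //; apply/eqP; move/eqP: E.
by rewrite cc subrr scale0r add0r scaler_eq0 oner_eq0 orbF subr_eq0.
Qed.

Lemma gal_scalar (sg : gT) (c : k) : sg c%:A = c%:A.
Proof. exact: rmorph_alg. Qed.

Lemma gal_theta_inj (x y : gT) : x th = y th -> x = y.
Proof.
move=> xy; apply/eqP/gal_eqP => a aL.
have {}aL : a \in <<1%AS; th>>%VS by rewrite th_gen memvf.
have /Fadjoin_polyP[q /polyOver1P[r ->] ->] := aL.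
have ev (z : gT) : z (map_poly (GRing.in_alg L) r).[th] = (map_poly (GRing.in_alg L) r).[z th].
  rewrite -horner_map -map_poly_comp; congr (_.[_]); apply: eq_map_poly => c.
  exact: gal_scalar.
by rewrite !ev xy.
Qed.

Lemma coord_eq (x : gT) c b : x th = c%:A * th + b%:A -> chi x = c /\ be x = b.
Proof. by have [_ ->] := coordE x; apply: affine_inj. Qed.

Lemma coordM (x y : gT) : chi (x * y)%g = chi x * chi y /\
  be (x * y)%g = chi x * be y + be x.
Proof.
apply: coord_eq; rewrite galM ?memvf // (coordE x).2 rmorphD rmorphM /= !gal_scalar.
rewrite (coordE y).2 mulrDr mulrA -addrA.
by rewrite !mulr_algl !scalerA !mulr_algl scalerDl.
Qed.

Lemma coord1 : chi 1%g = 1 /\ be 1%g = 0.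
Proof. by apply: coord_eq; rewrite gal_id scale1r mul1r scale0r addr0. Qed.

Lemma coord_trivial (x : gT) : chi x = 1 -> be x = 0 -> x = 1%g.
Proof.
move=> cx bx; apply: gal_theta_inj.
by rewrite (coordE x).2 cx bx gal_id scale1r mul1r scale0r addr0.
Qed.

Lemma chiX (x : gT) i : chi (x ^+ i)%g = chi x ^+ i.
Proof.
by elim: i => [|i IH]; rewrite ?expg0 ?coord1.1 // expgS (coordM _ _).1 IH exprS.
Qed.

Lemma chiJ (x y : gT) : chi (x ^ y)%g = chi x.
Proof.
rewrite conjgE (coordM _ _).1 (coordM _ _).1 mulrCA -(coordM _ _).1 mulVg.
by rewrite coord1.1 mulr1.
Qed.

Definition translations : {set gT} := [set x in G | chi x == 1].

Lemma translations_group_set : group_set translations.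
Proof.
apply/group_setP; split; first by rewrite inE group1 coord1.1 eqxx.
move=> x y; rewrite !inE => /andP[xG /eqP cx] /andP[yG /eqP cy].
by rewrite groupM // (coordM _ _).1 cx cy mulr1 eqxx.
Qed.

Let N : {group gT} := Group translations_group_set.

Lemma mem_translations x : (x \in N) = (x \in G) && (chi x == 1).
Proof. by rewrite /= inE. Qed.

Lemma translations_normal : (N <| G)%g.
Proof.
apply/normalP; split; first by apply/fintype.subsetP => x; rewrite mem_translations => /andP[].
move=> x xG; apply/setP => y; rewrite mem_conjg !mem_translations chiJ.
by rewrite groupJr ?groupV.
Qed.

Lemma translationX x i : x \in N -> be (x ^+ i)%g = be x *+ i.
Proof.
move=> xN; elim: i => [|i IH]; first by rewrite expg0 coord1.2 mulr0n.
move: (xN); rewrite mem_translations => /andP[_ /eqP cx].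
by rewrite expgS (coordM _ _).2 cx mul1r IH mulrSr.
Qed.

(** On [H] the character [chi] has trivial kernel, hence cyclicity. If x in [H] commutes with a
    translation y, then [be y = chi x * be y], so one of them is trivial; thus [H] permutes the
    nontrivial elements of [N] in orbits of size [#|H|]. *)
Lemma complement_structure (H : {group gT}) :
  H \in [complements to N in G]%g -> [/\ (N ><| H = G)%g, cyclic H & (#|H| %| #|N|.-1)%N].
Proof.
move=> /complP[NH1 NHG].
have sHG : H \subset G by rewrite -NHG mulG_subr.
have nNH : H \subset 'N(N)%g.
  by apply: fintype.subset_trans sHG _; case/andP: translations_normal.
have chiH x : x \in H -> chi x = 1 -> x = 1%g.
  move=> xH cx; apply/set1gP; rewrite -NH1 inE xH andbT mem_translations.
  by rewrite (fintype.subsetP sHG) // cx eqxx.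
split; first by rewrite sdprodE.
  apply: (@field_mul_group_cyclic _ H k chi) => [x y _ _|x xH]; first exact: (coordM _ _).1.
  by split=> [|->]; [apply: chiH|apply: coord1.1].
apply: regular_norm_dvd_pred nNH _ => x /setD1P[x1 xH]; apply/trivgP; apply/fintype.subsetP => y.
rewrite inE mem_translations => /andP[/andP[yG /eqP cy] /cent1P yx].
have := congr1 be yx; rewrite (coordM _ _).2 [in RHS](coordM _ _).2 cy mul1r addrC.
move/(addIr _)/eqP => E.
apply/set1gP; apply: coord_trivial => //; apply/eqP; apply: contraNT x1 => by0.
apply/eqP; apply: chiH => //; apply: (mulIf by0); rewrite mul1r.
exact/esym/eqP.
Qed.

(** The order of a translation, multiplied by its [be], is 0, so in characteristic 0 only the
    identity is a translation and [chi] is injective. *)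
Lemma affine_char0 : [pchar k] =i pred0 ->
  cyclic G /\ (1%G ><| G = G)%g.
Proof.
move=> /pcharf0P ch0; split; last exact: sdprod1g.
apply: (@field_mul_group_cyclic _ G k chi) => [x y _ _|x xG]; first exact: (coordM _ _).1.
split=> [cx|->]; last exact: coord1.1.
have xN : x \in N by rewrite mem_translations xG cx eqxx.
apply: coord_trivial => //; have := translationX #[x]%g xN.
rewrite expg_order coord1.2 -mulr_natl => /esym/eqP.
by rewrite mulf_eq0 ch0 eqn0Ngt order_gt0 /= => /eqP.
Qed.

Lemma translations_abelem p : p \in [pchar k] -> (p.-abelem N)%g.
Proof.
move=> chp; have pp := pcharf_prime chp; apply/(abelemP pp); split.
  apply/centsP => x xN y yN.
  move: (xN) (yN); rewrite !mem_translations => /andP[_ /eqP cx] /andP[_ /eqP cy].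
  suff E : (x * y = y * x)%g by [].
  apply: gal_theta_inj; rewrite !(coordE (_ * _)%g).2.
  rewrite !(coordM _ _).1 !(coordM _ _).2 cx cy !mul1r.
  by rewrite [be y + be x]addrC.
move=> x xN; apply: coord_trivial.
  by rewrite chiX; move: xN; rewrite mem_translations => /andP[_ /eqP ->]; rewrite expr1n.
by rewrite translationX // -mulr_natl (pcharf0 chp) mul0r.
Qed.

(** [chi] sends a p-element to a root of unity of p-power order, which is 1 in characteristic p;
    hence a Sylow subgroup consists of translations. *)
Lemma translations_Sylow p : p \in [pchar k] -> (p.-Sylow(G) N)%g.
Proof.
move=> chp; have [S sylS] := Sylow_exists p G.
have sNG : N \subset G by apply/fintype.subsetP => x; rewrite mem_translations => /andP[].
have pN : (p.-group N)%g by apply: abelem_pgroup (translations_abelem chp).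
have sSN : S \subset N.
  apply/fintype.subsetP => x xS; rewrite mem_translations.
  rewrite (fintype.subsetP (pHall_sub sylS)) //=.
  have /p_natP[j oj] := mem_p_elt (pHall_pgroup sylS) xS.
  apply/eqP; apply: (pchar_root_of_unity_eq1 (j := j) chp).
  by rewrite -chiX -oj expg_order coord1.1.
have := sub_pHall sylS pN sSN sNG.
move=> E; rewrite pHallE sNG /= -(card_Hall sylS) -E.
exact: eqxx.
Qed.

Theorem affine_galois_structure (p e l : nat) :
  has_char k p -> #|G| = (p ^ e * l)%N -> ((0 < p)%N -> ~~ (p %| l)%N) ->
  (p = 0%N -> e = 0%N) ->
  (l %| p ^ e - 1)%N /\ is_semidirect_elab_cyclic G p e l.
Proof.
move=> hp oG hl he; have l_gt0 : (0 < l)%N.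
  by have := cardG_gt0 G; rewrite oG muln_gt0 => /andP[].
have Hl (H : {group gT}) : cyclic H -> #|H| = l -> (H \isog Zp l)%g.
  move=> cH oH; have := isog_cyclic_card (Zp_group l) cH; rewrite oH card_Zp // eqxx andbT.
  move=> ->; rewrite /= /Zp; case: ifP => _; last exact: cyclic1.
  by apply/cyclicP; exists Zp1; rewrite Zp_cycle.
have [p0|p_gt0] := posnP p.
  move: hp; rewrite /has_char p0 eqxx => /affine_char0[cG sdG].
  move: oG; rewrite p0 (he p0) expn0 mul1n => oG.
  split; first by rewrite subnn dvdn0.
  exists 1%G, G; split=> //; last exact: Hl.
  (* Row vectors of length 0 form the trivial group, whatever ['Z_0] denotes. *)
  apply: (trivial_isog (G := [1 gT]) (H := [set: 'rV['Z_0]_0]%G)) => //=.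
  by apply/setP => x; rewrite !inE [x]thinmx0 eqxx.
move: hp; rewrite /has_char gtn_eqF // => chp; have pp := pcharf_prime chp.
have sylN := translations_Sylow chp.
have oN : #|N| = (p ^ e)%N.
  rewrite (card_Hall sylN) oG partnM ?expn_gt0 ?p_gt0 //.
  rewrite part_pnat_id ?pnatX ?pnat_id // part_p'nat ?muln1 //.
  by rewrite p'natE // hl.
have [H Hcompl] : exists H : {group gT}, H \in [complements to N in G]%g.
  apply/splitsP; apply: SchurZassenhaus_split translations_normal.
  exact: pHall_Hall sylN.
have [sdNH cH dvdH] := complement_structure Hcompl.
have oH : #|H| = l.
  have := sdprod_card sdNH; rewrite oN oG => /eqP.
  by rewrite eqn_pmul2l ?expn_gt0 ?p_gt0 // => /eqP.
split; first by move: dvdH; rewrite oH oN subn1.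
exists N, H; split=> //; last exact: Hl.
rewrite (isog_abelem_card _ (translations_abelem chp)) rowspace_abelem //=.
rewrite cardsT card_mx mul1n card_ord Zp_cast ?prime_gt1 // oN.
exact: eqxx.
Qed.


End AffineGroup.

(** * Projection coordinates *)

Lemma muni_mderiv_widen (R : idomainType) (n : nat) (p : {mpoly R[n.+1]}) (j : 'I_n) i :
  (muni p^`M(wid j))`_i = ((muni p)`_i)^`M(j).
Proof.
suff E : muni p^`M(wid j) = map_poly (mderiv j) (muni p) by rewrite E coef_map.
elim/mpoly_gen_ind: p => [c|l|p q IHp IHq|p q IHp IHq].
- by rewrite mderivC muniC map_polyC /= mderivC muni0.
- have [->|[t ->]] := ord_last_or_widen l.
    rewrite mderiv_var muniC muniX_last (_ : (_ == _) = false); last first.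
      by rewrite -val_eqE /= gtn_eqF.
    apply/polyP => s; rewrite coefC coef_map coefX mpolyC0.
    by case: (s == 1)%N; rewrite ?mderivC -?mpolyC1 /= ?mderivC ?if_same // mderiv0 if_same.
  by rewrite mderiv_var muniC muniX_widen map_polyC /= mderiv_var.
- by rewrite mderivD (muniD p^`M(_)) (muniD p) raddfD /=; congr (_ + _); [exact: IHp|exact: IHq].
- rewrite mderivM (muniD (p^`M(_) * q)) (muniM p^`M(_)) !(muniM p).
  transitivity (map_poly (mderiv j) (muni p) * muni q + muni p * map_poly (mderiv j) (muni q)).
    by congr (_ * _ + _ * _); [exact: IHp|exact: IHq].
  move: (muni p) (muni q) => P Q; apply/polyP => s.
  rewrite coefD !coefM coef_map coefM /= raddf_sum -big_split; apply: eq_bigr => t _ /=.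
  by rewrite !coef_map mderivM.
Qed.

Section ProjectionCoordinates.
Variables (K : fieldType) (N : nat) (P : 'rV[K]_N.+1) (M : 'M[K]_(N.+1, N)).
Hypotheses (P0 : P != 0) (rM : \rank M = N) (PM : P *m M = 0).

(* Coordinates in which the center [P] is the last coordinate point and the
   projection from [P] forgets the last coordinate. *)
Lemma projection_coordinates : exists T : 'M[K]_N.+1, [/\ T \in unitmx,
  forall i j, T (wid i) j = M j i & forall i, \sum_j T i j * P 0 j = (i == ord_max)%:R].
Proof.
have [j0 Pj0] : exists j, P 0 j != 0.
  apply: contrapT => H; case/eqP: P0; apply/rowP => j; rewrite mxE.
  by apply/eqP/negPn/negP => Pj; apply: H; exists j.
pose u j : K := (P 0 j0)^-1 * (j == j0)%:R.
have Pu : \sum_j u j * P 0 j = 1.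
  rewrite (bigD1 j0) //= /u eqxx mulr1 mulVf // big1 ?addr0 // => j /negbTE ->.
  by rewrite mulr0 mul0r.
pose T : 'M[K]_N.+1 := \matrix_(i, j) if unlift ord_max i is Some i' then M j i' else u j.
have TW i j : T (wid i) j = M j i.
  have -> : wid i = lift ord_max i by apply/val_inj; rewrite /= /bump leqNgt ltn_ord.
  by rewrite mxE liftK.
have TL j : T ord_max j = u j by rewrite mxE unlift_none.
exists T; split=> // [|i]; last first.
  have [->|[i' ->]] := ord_last_or_widen i.
    by rewrite eqxx -[RHS]Pu; apply: eq_bigr => j _; rewrite TL.
  rewrite (_ : (wid i' == ord_max) = false); last by rewrite -val_eqE /= ltn_eqF.
  have := congr1 (fun A : 'rV_N => A 0 i') PM; rewrite !mxE => E; rewrite -[RHS]E.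
  by apply: eq_bigr => j _; rewrite TW mulrC.
(* A vector killed by all rows of [T] lies in the kernel of the projection, which is the line of
   [P]; the last row takes the value 1 at [P], so the vector is 0. *)
rewrite -unitmx_tr -row_free_unit; apply: inj_row_free => x xT.
have xT' i : \sum_j x 0 j * T i j = 0.
  have := congr1 (fun A : 'rV_N.+1 => A 0 i) xT; rewrite !mxE => E; rewrite -[RHS]E.
  by apply: eq_bigr => j _; rewrite !mxE.
have xM : (x <= kermx M)%MS.
  apply/sub_kermxP/rowP => i; rewrite !mxE -[RHS](xT' (wid i)).
  by apply: eq_bigr => j _; rewrite TW.
have PK : (P <= kermx M)%MS by apply/sub_kermxP.
have : (kermx M <= P)%MS.
  rewrite -(mxrank_leqif_sup PK) mxrank_ker rM subSnn.
  by rewrite rank_rV P0.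
move/(submx_trans xM)/sub_rVP => [c xE].
have := xT' ord_max; rewrite xE.
under eq_bigr => j _ do rewrite mxE TL -mulrA [P 0 j * _]mulrC.
by rewrite -mulr_sumr Pu mulr1 => ->; rewrite scale0r.
Qed.

End ProjectionCoordinates.

Lemma size_muni_off_center (R : idomainType) (n d : nat) (F : {mpoly R[n.+1]}) :
  F \is d.-homog -> F.@[@last_point n R] != 0 -> size (muni F) = d.+1.
Proof.
move=> hF Fl; apply/eqP; rewrite eqn_leq size_muni_homog //= ltnNge.
apply/negP => /leq_sizeP/(_ d (leqnn d)); rewrite meval_last_point // => /eqP.
by rewrite mpolyC_eq0 (negbTE Fl).
Qed.

(** The partial derivatives at the last point are read off the coefficients of the powers d and d -
    1 of the last variable. The former is zero on the hypersurface, so smoothness forces the latter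
    to be nonzero. *)
Lemma size_muni_smooth_center (R : idomainType) (n d : nat) (F : {mpoly R[n.+1]}) j :
  F \is d.-homog -> (0 < d)%N -> F.@[@last_point n R] = 0 ->
  (F^`M(j)).@[@last_point n R] != 0 -> size (muni F) = d.
Proof.
move=> hF d0 Fl Fj.
have cd : (muni F)`_d = 0 by rewrite meval_last_point // Fl mpolyC0.
have cj := meval_last_point (dhomog_mderiv j hF).
have sle : (size (muni F) <= d)%N.
  apply/leq_sizeP => i; rewrite leq_eqVlt => /orP[/eqP <- //|lt].
  by rewrite nth_default // (leq_trans (size_muni_homog hF)).
apply/eqP; rewrite eqn_leq sle -(prednK d0) ltnNge.
apply/negP => /leq_sizeP/(_ d.-1 (leqnn _)) cd1.
suff E : (muni F^`M(j))`_d.-1 = 0.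
  by move/eqP: E; rewrite cj mpolyC_eq0 (negbTE Fj).
have [->|[t ->]] := ord_last_or_widen j.
  by rewrite muni_deriv coef_deriv prednK // cd mul0rn.
by rewrite muni_mderiv_widen cd1 mderiv0.
Qed.

Lemma dvds_principal (R : comNzRingType) (F x : R) : dvds F x <-> x \in principal F.
Proof. by split=> [|/asboolP]; [move=> H; apply/asboolP|]. Qed.

Theorem corollary2 (K : closedFieldType) (p : nat) (hp : has_char K p)
  (n d : nat) (hn : (1 <= n)%N) (hd : (4 <= d)%N)
  (X : hypersurface K n d)
  (s : int) (hs : is_dim (sing_locus X) s) (hsn : s <= n%:Z - 2)
  (P : 'rV[K]_n.+2) (gP : galois_point X P)
  (e l : nat)
  (hdl : if on_hs X P then (d - 1 = p ^ e * l)%N else (d = p ^ e * l)%N)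
  (hl : (0 < p)%N -> ~~ (p %| l)%N)
  (he : p = 0%N -> e = 0%N) :
  (l %| p ^ e - 1)%N /\ is_semidirect_elab_cyclic (galois_group gP) p e l.
Proof.
case: n hn X s hs hsn P gP hdl => [//|n] _ X s [hs _] hsn P gP hdl.
set F := equation X.
have hF : F \is d.-homog := equation_homog X.
have d_gt0 : (0 < d)%N by apply: leq_trans hd.
have pF : prime_elt F.
  split; first by move/dvds_principal => H; have := equation_proper X; rewrite H.
  move=> a b /dvds_principal ab.
  by have /orP[] := @equation_prime _ _ _ X a b ab; [left|right]; apply/dvds_principal.
(* After the case analysis [X] has dimension n + 1, so the bound on [s] reads s <= n - 1 and
   excludes chains of length n. *)
have noC m : (n <= m)%N -> ~ irreducible_chain (singular_cone F) m.
  move=> nm chain; have := hs m; rewrite (_ : sing_locus X = singular_cone F).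
    by move=> /(_ chain); lia.
  by apply/seteqP; split=> v [v0 /eqP Fv Fd]; split=> //; apply/eqP.
have [rM PM] := gp_projP gP.
have [T [uT TW TP]] := projection_coordinates (gp_neq0 gP) rM PM.
(* [psi] rewrites a polynomial in the adapted coordinates as one in the original coordinates; [F1]
   is the equation of [X] in the adapted ones. *)
pose psi : {rmorphism {mpoly K[n.+3]} -> {mpoly K[n.+3]}} := comp_mpoly (linear_forms T).
pose phi : {rmorphism {mpoly K[n.+3]} -> {mpoly K[n.+3]}} :=
  comp_mpoly (linear_forms (invmx T)).
have psiK : cancel psi phi := comp_linearK uT.
have phiK : cancel phi psi := comp_linearKV uT.
pose F1 := phi F.
have hF1 : F1 \is d.-homog.
  by apply: dhomog_comp hF => i; apply: linear_forms_homog.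
have FE : F = psi F1 by rewrite /F1 phiK.
have psi_meval g : peval (psi g) P = g.@[@last_point n.+2 K].
  by rewrite /peval meval_linear; apply: meval_eq => i; rewrite TP.
have dvds_psi x : dvds F (psi x) <-> dvds F1 x.
  by apply: (iso_dvds phiK psiK (e := 1) (e' := 1)); rewrite mul1r.
have norm1 G H : ~ dvds F1 H -> integral_mod F1 G H -> comb F1 H G.
  move=> nH intGH; apply/(iso_comb phiK psiK (e := 1) (e' := 1) (f := F)).
  - by rewrite mul1r.
  - by rewrite mul1r.
  apply: (normal_hypersurface d_gt0 hF (equation_neq0 X) pF noC).
    by move/dvds_psi.
  by apply: (iso_integral_mod phiK (e' := 1)) intGH; rewrite mul1r.
have FP : peval F P = F1.@[@last_point n.+2 K] by rewrite FE psi_meval.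
(* The two cases of the theorem become one: [m] is the degree of [F1] in the last variable and [dl]
   the degree of its leading coefficient. *)
have [m [dl [sF1 dE dl_le1 mE]]] : exists m dl,
    [/\ size (muni F1) = m.+1, d = (m + dl)%N, (dl <= 1)%N & m = (p ^ e * l)%N].
  move: hdl; rewrite /on_hs -/F; case: eqP => FP0 dE; last first.
    exists d, 0%N; rewrite addn0; split=> //; apply: size_muni_off_center => //.
    by rewrite -FP; apply/eqP.
  exists d.-1, 1%N; rewrite addn1 prednK // -dE subn1; split=> //.
  have [[_ _ [i Fi]]|] := gp_smooth gP; last by rewrite /on_hs -/F FP0 eqxx.
  have [j Fj] : exists j, (F1^`M(j)).@[@last_point n.+2 K] != 0.
    apply: contrapT => H; case/eqP: Fi; rewrite -/F FE mderiv_linear.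
    rewrite /peval rmorph_sum big1 // => j _ /=.
    rewrite mevalZ; have := psi_meval F1^`M(j); rewrite /peval => ->.
    suff -> : (F1^`M(j)).@[@last_point n.+2 K] = 0 by rewrite mulr0.
    by apply/eqP/negPn/negP => Fj; apply: H; exists j.
  by apply: size_muni_smooth_center hF1 d_gt0 _ Fj; rewrite -FP.
have m_gt2 : (2 < m)%N by move: hd; rewrite dE; lia.
rewrite dE in hF1.
have [ev evE] : exists ev : {rmorphism {mpoly K[n.+3]} -> {fraction coord_ring X}},
    forall g, ev g = tofrac (coord_class X (psi g)).
  pose cc : {rmorphism {mpoly K[n.+3]} -> coord_ring X} := @coord_class _ _ _ X.
  pose tf : {rmorphism coord_ring X -> {fraction coord_ring X}} := @tofrac _.
  by exists (tf \o cc \o psi).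
have class0 x : (coord_class X x == 0) = (x \in hs_ideal X).
  have -> : 0 = coord_class X 0 by rewrite /coord_class rmorph0.
  by rewrite /coord_class -Quotient.idealrBE subr0.
have ev_eq0 g : (ev g == 0) = (psi g \in hs_ideal X) by rewrite evE tofrac_eq0 class0.
have ev_ker g : ev g = 0 <-> dvds F1 g.
  split=> [/eqP|/dvds_psi/dvds_principal H]; last by apply/eqP; rewrite ev_eq0.
  by rewrite ev_eq0 => /dvds_principal/dvds_psi.
have fracE G H : coord_frac X (psi G) (psi H) = ev G / ev H by rewrite /coord_frac !evE.
have psi_homog g j : g \is j.-homog -> psi g \is j.-homog.
  by move=> hg; apply: dhomog_comp hg => i; apply: linear_forms_homog.
have phi_homog g j : g \is j.-homog -> phi g \is j.-homog.
  by move=> hg; apply: dhomog_comp hg => i; apply: linear_forms_homog.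
have emb_top x : (exists a, x = gp_emb gP a) <-> exists j G H,
    [/\ G \is j.-homog, H \is j.-homog, ev H != 0 & x = ev G / ev H].
  split=> [[a ->]|[j [G [H [hG hH H0 ->]]]]].
    have : function_field X (gp_emb gP a) by rewrite -(gp_top_image gP); exists a.
    move=> [j [G [H [hG hH H0 ->]]]]; exists j, (phi G), (phi H); split.
    - exact: phi_homog.
    - exact: phi_homog.
    - by rewrite ev_eq0 phiK.
    - by rewrite -fracE !phiK.
  have : function_field X (ev G / ev H).
    exists j, (psi G), (psi H); split; [exact: psi_homog|exact: psi_homog| |by rewrite fracE].
    by rewrite -ev_eq0.
  by rewrite -(gp_top_image gP) => -[a _ aE]; exists a.
(* Pull-backs along the projection are the polynomials free of the last adapted variable, so the
   image of the base field is described by [mwiden]. *)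
have proj_psi g : g \mPo projection_forms (gp_proj gP) = psi (mwiden g).
  elim/mpoly_gen_ind: g => [c|i|q r IHq IHr|q r IHq IHr].
  - by rewrite mwidenC /psi /= !comp_mpolyC.
  - rewrite mwidenX_widen /psi /= comp_linear_var comp_mpolyXU -tnth_nth tnth_mktuple.
    by apply: eq_bigr => j _; rewrite TW.
  - by rewrite mwidenD (rmorphD psi) comp_mpolyD IHq IHr.
  - by rewrite mwidenM (rmorphM psi) rmorphM /= IHq IHr.
have emb_base x : (exists c : gp_base gP, x = gp_emb gP c%:A) <-> exists j g h,
    [/\ g \is j.-homog, h \is j.-homog, ev (mwiden h) != 0
      & x = ev (mwiden g) / ev (mwiden h)].
  split=> [[a ->]|[j [g [h [hg hh h0 ->]]]]].
    have : @pullback_field _ _ _ X (gp_proj gP) (gp_emb gP a%:A).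
      by rewrite -(gp_base_image gP); exists a.
    move=> [j [g [h [hg hh h0 ->]]]]; exists j, g, h; rewrite -fracE -!proj_psi.
    by split=> //; rewrite ev_eq0 -proj_psi.
  have : @pullback_field _ _ _ X (gp_proj gP) (ev (mwiden g) / ev (mwiden h)).
    by exists j, g, h; rewrite -fracE -!proj_psi; split=> //; rewrite proj_psi -ev_eq0.
  by rewrite -(gp_base_image gP) => -[a _ aE]; exists a.
have [th thE] := theta_exists sF1 m_gt2 ev_ker emb_top.
have th_gen := theta_generates sF1 m_gt2 ev_ker emb_top emb_base thE.
have th_deg := theta_degree sF1 m_gt2 hF1 ev_ker emb_base thE.
have th_aff := conjugate_affine sF1 m_gt2 dl_le1 hF1 norm1 ev_ker emb_top emb_base thE.
have th_nbase : th \notin 1%AS.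
  by rewrite -adjoin_deg_eq1 th_deg; apply/eqP => m1; rewrite m1 in m_gt2.
have oG : #|'Gal({:gp_top gP} / 1)%g| = (p ^ e * l)%N.
  rewrite -(galois_dim (gp_galois gP)) -mE -th_deg adjoin_degreeE.
  by rewrite -th_gen.
(* [K] and the base of the Galois extension both embed in the fraction field of the coordinate ring,
   so they have the same characteristic. *)
have hpk : has_char (gp_base gP) p.
  have EK := fmorph_pchar (ev \o @mpolyC n.+3 K).
  have Ek := fmorph_pchar (gp_emb gP \o GRing.in_alg (gp_top gP)).
  move: hp; rewrite /has_char; case: ifP => _ hp' ; last by rewrite -Ek EK.
  by move=> q; rewrite -Ek EK hp'.
have [chi [be coordE]] := affine_coordinates th_aff.
exact: (affine_galois_structure th_gen th_nbase coordE hpk oG hl he).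
Qed.
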